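(* Let $n\ge1$ and $\mathbf i\in\Sigma_{n+1}$. Suppose there exists $(\sigma_1,\dots,\sigma_n)\in\{A,D\}^n$ such that $\mathrm{ind}_{\sigma_k}\big(C_{\sigma_{k+1}}\circ\cdots\circ C_{\sigma_n}(\mathbf i)\big)=0$ for all $k=n,\dots,1$. Then for every dominant integral weight $\lambda$, the string polytope $\Delta_{\mathbf i}(\lambda)$ is unimodularly equivalent to the Gelfand–Cetlin polytope $GC(\lambda)$.
   Context: $N=n(n+1)/2$; $\Sigma_{n+1}$: reduced words $\mathbf i=(i_1,\dots,i_N)$ of the longest element of $\mathfrak S_{n+1}$ in $s_i=(i,i+1)$. Wiring diagram $G(\mathbf i)$: $n+1$ wires $\ell_1,\dots,\ell_{n+1}$ run top to bottom through positions $1,\dots,n+1$; at the top $\ell_k$ is in position $k$; the $j$-th node $t_j$ swaps the wires in positions $i_j,i_j+1$; at the bottom $\ell_k$ is in position $n+2-k$ and ends at $L_k$. $t_j$ also denotes the $j$-th coordinate of $\mathbb R^N$. Rigorous paths: for $k\in[n]$, $G(\mathbf i,k)$ has $\ell_1,\dots,\ell_k$ oriented upward, the rest downward. A rigorous path in $G(\mathbf i,k)$ starts at $L_k$, ends at $L_{k+1}$, moves along wires in their orientation, switches wires only at their crossing node, passes each node at most once, and never passes straight through $\ell_a\cap\ell_b$ while on $\ell_a$ when both are downward with $a>b$ or both upward with $a<b$. String inequality of $P$: $\sum_ja_jt_j\ge0$ with $a_j=1$ (resp. $-1$) if $P$ switches at $t_j$ from $\ell_r$ to $\ell_s$ with $r<s$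 (resp. $r>s$), else $0$. $\lambda=\sum\lambda_i\varpi_i$ ($\varpi_i$ fundamental weights) is dominant integral if all $\lambda_i\in\mathbb Z_{\ge0}$. $\lambda$-inequality of $t_j$: $t_j\le\lambda_{i_j}+\sum_{k>j}a_kt_k$ with $a_k=1$ if $|i_k-i_j|=1$, $-2$ if $i_k=i_j$, $0$ otherwise. $\Delta_{\mathbf i}(\lambda)$: points of $\mathbb R^N$ satisfying all string and all $\lambda$-inequalities. $GC(\lambda)\subset\mathbb R^N$ (coordinates $x_{k,j}$, $1\le j\le k\le n$): $x_{k+1,j}\ge x_{k,j}\ge x_{k+1,j+1}$ for all $1\le j\le k\le n$, where $x_{n+1,j}=\lambda_j+\cdots+\lambda_n$, $x_{n+1,n+1}=0$. Unimodular equivalence: an affine map $x\mapsto Mx+v$, $M\in GL_N(\mathbb Z)$, $v\in\mathbb Z^N$, mapping one onto the other. Indices/contractions: 2-moves exchange adjacent letters $i,j$ with $|i-j|>1$, generating $\sim$. Every $\mathbf i$ satisfies $\mathbf i\sim\mathbf i_D^-(n,\dots,1)\mathbf i_D^+\sim\mathbf i_A^-(1,\dots,n)\mathbf i_A^+$; $\mathrm{ind}_D(\mathbf i)=|\mathbf i_D^+|$, $\mathrm{ind}_A(\mathbf i)=|\mathbf i_A^+|$; $C_D(\mathbf i)=\mathbf i_D^-(\mathbf i_D^+-1)\in\Sigma_n$, $C_A(\mathbf i)=(\mathbf i_A^--1)\mathbf i_A^+\in\Sigma_n$ ($\mathbf w\pm1$ adds $\pm1$ to each letter; well defined up to $\sim$;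 indices are invariant under $\sim$). *)

(* Defs.v *)
From HB Require Import structures.
From mathcomp Require Import all_boot all_order all_algebra.
From Stdlib Require Import Relations.
Set Implicit Arguments. Unset Strict Implicit. Unset Printing Implicit Defensive.
Import Order.TTheory GRing.Theory Num.Theory.

(* Conventions: letters, positions, wires and nodes are 1-based natural
   numbers, as in the paper.  Words are [seq nat]. *)

Definition NN (n : nat) : nat := (n * n.+1) %/ 2.

Definition swapAt (s : seq nat) (p : nat) : seq nat :=
  [seq nth 0 s (if q == p.-1 then p else if q == p then p.-1 else q)
  | q <- iota 0 (size s)].

(* arrangement of the wires (list indexed by positions 1..n+1, giving the
   label k of the wire l_k occupying that position) after the first m nodes *)
Definition arr (n : nat) (i : seq nat) (m : nat) : seq nat :=
  foldl swapAt (iota 1 n.+1) (take m i).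

Definition ix (i : seq nat) (j : nat) : nat := nth 0 i j.-1.

(* the two wires crossing at node t_j (positions i_j and i_j + 1 just
   before the swap) *)
Definition wireU (n : nat) (i : seq nat) (j : nat) : nat := nth 0 (arr n i j.-1) (ix i j).-1.
Definition wireL (n : nat) (i : seq nat) (j : nat) : nat := nth 0 (arr n i j.-1) (ix i j).

Definition onNode (n : nat) (i : seq nat) (w j : nat) : bool := (w == wireU n i j) || (w == wireL n i j).
Definition other (n : nat) (i : seq nat) (w j : nat) : nat := if w == wireU n i j then wireL n i j else wireU n i j.

Definition inv_count (s : seq nat) : nat :=
  \sum_(p < size s) \sum_(q < size s | p < q) (nth 0 s q < nth 0 s p).

(* i is a reduced word (length = Coxeter length of its product) in the
   s_1,..,s_n whose product is the longest element w0 of S_{n+1} *)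
Definition Sigma (n : nat) (i : seq nat) : bool :=
  [&& all (fun a => 0 < a <= n) i,
      arr n i (size i) == rev (iota 1 n.+1)
    & size i == inv_count (arr n i (size i))].

(* in G(i,k), wires l_1..l_k are oriented upward, the others downward *)
Definition up (k w : nat) : bool := w <= k.

(* A path is encoded by its list of switches [(j_1,w_1);...;(j_m,w_m)]:
   starting at L_k on w_0 = l_k, it runs along w_{t-1} to the node t_{j_t}
   where it switches to w_t; after the last switch it runs along w_m down to
   the bottom end.  Node "N+1" denotes the bottom ends of the wires. *)
Definition segs (n : nat) (i : seq nat) (k : nat) (p : seq (nat * nat)) : seq (nat * nat * nat) :=
  let js := (NN n).+1 :: map fst p in
  let es := rcons (map fst p) (NN n).+1 in
  let ws := k :: map snd p in
  [seq ((x.1, x.2.1), x.2.2) | x <- zip js (zip es ws)].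

Definition seg_dir (k : nat) (s : nat * nat * nat) : bool :=
  let: (a, b, w) := s in if up k w then b < a else a < b.

Definition seg_inner (n : nat) (i : seq nat) (s : nat * nat * nat) : seq nat :=
  let: (a, b, w) := s in
  [seq l <- iota 1 (NN n) | onNode n i w l && (minn a b < l < maxn a b)].

(* never pass straight through l_a \cap l_b while on l_a when both are
   downward with a > b or both upward with a < b *)
Definition seg_ok (n : nat) (i : seq nat) (k : nat) (s : nat * nat * nat) : bool :=
  let: (a, b, w) := s in
  all (fun l => let w' := other n i w l in
          ~~ [&& ~~ up k w, ~~ up k w' & w' < w] &&
          ~~ [&& up k w, up k w' & w < w'])
      (seg_inner n i s).

Definition switch_ok (n : nat) (i : seq nat) (x : nat * (nat * nat)) : bool :=
  let: (wprev, (j, w)) := x in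
  [&& 0 < j <= NN n, onNode n i wprev j & w == other n i wprev j].

Definition rigorous (n : nat) (i : seq nat) (k : nat) (p : seq (nat * nat)) : bool :=
  [&& all (switch_ok n i) (zip (k :: map snd p) p),
      last k (map snd p) == k.+1,
      all (seg_dir k) (segs n i k p),
      all (seg_ok n i k) (segs n i k p)
    & uniq (map fst p ++ flatten (map (seg_inner n i) (segs n i k p)))].

Definition strCoef (k : nat) (p : seq (nat * nat)) (j : nat) : int :=
  \sum_(x <- zip (k :: map snd p) p)
     (if x.2.1 == j then (if (x.1 < x.2.2)%N then 1 else -1) else 0)%R.

Definition lamCoef (i : seq nat) (j l : nat) : int :=
  let a := ix i j in let b := ix i l in
  (if b == a then -2 else if ((b == a.+1) || (a == b.+1))%N then 1 else 0)%R.

(* coordinate t_j of x is x 0 (j-1) *)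
Definition stringPoly (R : realFieldType) (n : nat) (i : seq nat)
    (lam : nat -> nat) (x : 'rV[R]_(NN n)) : Prop :=
  (forall k p, 1 <= k <= n -> rigorous n i k p ->
      (0 <= \sum_(j < NN n) (strCoef k p j.+1)%:~R * x 0 j)%R) /\
  (forall j : 'I_(NN n),
      (x 0 j <= (lam (ix i j.+1))%:R
               + \sum_(l < NN n | (val j < val l)%N) (lamCoef i j.+1 l.+1)%:~R * x 0 l)%R).

(* coordinate number m (0-based; 0 if out of range) of y *)
Definition coord (R : realFieldType) N (y : 'rV[R]_N) (m : nat) : R :=
  (\sum_(q < N | val q == m) y 0 q)%R.

(* the coordinate x_{k,j} (1 <= j <= k <= n) is stored at index C(k,2)+j-1 *)
Definition gcIdx (k j : nat) : nat := 'C(k, 2) + j.-1.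

Definition gcx (R : realFieldType) (n : nat) (lam : nat -> nat)
    (y : 'rV[R]_(NN n)) (k j : nat) : R :=
  if k == n.+1 then ((\sum_(j <= l < n.+1) lam l)%N%:R)%R else coord y (gcIdx k j).

Definition GCpoly (R : realFieldType) (n : nat) (lam : nat -> nat)
    (y : 'rV[R]_(NN n)) : Prop :=
  forall k j, 1 <= j -> j <= k -> k <= n ->
    (gcx lam y k.+1 j >= gcx lam y k j)%R /\ (gcx lam y k j >= gcx lam y k.+1 j.+1)%R.

Definition unimodEquiv (R : realFieldType) (N : nat)
    (P Q : 'rV[R]_N -> Prop) : Prop :=
  exists (M : 'M[int]_N) (v : 'rV[int]_N),
    M \in unitmx /\
    let f := fun x : 'rV[R]_N =>
      (x *m map_mx (fun z : int => z%:~R) M + map_mx (fun z : int => z%:~R) v)%R in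
    (forall x, P x -> Q (f x)) /\ (forall y, Q y -> exists x, P x /\ f x = y).

Definition two_move (w w' : seq nat) : Prop :=
  exists u v a b, [/\ w = u ++ a :: b :: v, w' = u ++ b :: a :: v
                    & (a.+1 < b) || (b.+1 < a)].

Definition wsim : relation (seq nat) := clos_refl_sym_trans _ two_move.

Inductive AD := A | D.

Definition chainAD (s : AD) (n : nat) : seq nat :=
  if s is D then rev (iota 1 n) else iota 1 n.

Definition decomp (s : AD) (n : nat) (w u v : seq nat) : Prop :=
  wsim w (u ++ chainAD s n ++ v).

Definition indIs (s : AD) (n : nat) (w : seq nat) (m : nat) : Prop :=
  exists u v, decomp s n w u v /\ size v = m.

Definition contrIs (s : AD) (n : nat) (w c : seq nat) : Prop :=
  exists u v, decomp s n w u v /\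
    wsim c (if s is D then u ++ map predn v else map predn u ++ v).

(* Main.v *)
Require Import Defs.
From HB Require Import structures.
From mathcomp Require Import all_boot all_order all_algebra.
From mathcomp Require Import zify ring lra.
From Stdlib Require Import Relations.
Set Implicit Arguments. Unset Strict Implicit. Unset Printing Implicit Defensive.
Import Order.TTheory GRing.Theory Num.Theory.

(** If all indices vanish, then up to 2-moves a word of rank n+1 is u followed by the
    chain (n+1, ..., 1) with u of rank n, or (u shifted by 1) followed by (1, ..., n+1).
    The chain is a single wire crossing all the others below the diagram of u.
    A rigorous path that meets the chain and turns onto that wire must leave it at
    the very next node, so the string cone of the word is the string cone of u
    times { c_1 >= ... >= c_(n+1) >= 0 } in the chain coordinates c.  The
    lambda-inequalities of the chain put the differences of consecutive c's
    into [0, lambda_a], which says that a suitable integral change of variables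
    turns c into a row z interlacing the top row mu of a Gelfand-Cetlin pattern,
    lambda_a = mu_a - mu_(a+1); the remaining lambda-inequalities are those
    of u for the weight given by the row z.  Hence the induction hypothesis has to be a
    unimodular equivalence that depends linearly on an arbitrary real top row. *)

(** * Reduced words *)

(** The index and the contraction are given by independent decompositions of the same word, so an
    empty tail in one of them has to be transferred to the other. This rests on two things that
    2-moves preserve: the number of occurrences of each letter and the order of neighbouring
    letters. That the contraction is again a reduced word of the longest element is then read off
    from the arrangement of the wires just above the chain.

    A 2-move costs only a transposition of two coordinates, because its two nodes share no wire and
    their letters do not interact in the lambda-inequalities. Rigour of a path depends only on which
    wires meet at each node; paths are therefore studied for arbitrary wire functions [U] and [L],
    and 2-moves, shifts of the wires and removal of the chain become instances of relabelling and
    extension. *)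

Lemma size_swapAt s p : size (swapAt s p) = size s.
Proof. by rewrite size_map size_iota. Qed.

Lemma swapAt_cat s1 x y s2 :
  swapAt (s1 ++ x :: y :: s2) (size s1).+1 = s1 ++ y :: x :: s2.
Proof.
apply: (@eq_from_nth _ 0); first by rewrite size_swapAt !size_cat.
move=> q; rewrite size_swapAt => lt_q.
rewrite (nth_map 0) ?size_iota // nth_iota // add0n /= !nth_cat /=.
case: (ltngtP q (size s1)) => [lt1|gt1|->].
- by rewrite (ltn_eqF (leqW lt1)) lt1.
- case: eqVneq => [->|ne]; first by rewrite ltnn subnn subSnn.
  rewrite ltnNge (ltnW gt1) /=.
  have -> : q - size s1 = (q - size s1 - 2).+2 by lia.
  by [].
by rewrite ltnNge leqnSn /= subnn subSnn.
Qed.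

Lemma split_at (s : seq nat) p : 0 < p < size s ->
  exists s1 x y s2, s = s1 ++ x :: y :: s2 /\ p = (size s1).+1.
Proof.
case: p => // p /= lt_p; exists (take p s), (nth 0 s p), (nth 0 s p.+1), (drop p.+2 s).
split; last by rewrite size_takel //; lia.
by rewrite -drop_nth // -drop_nth ?cat_take_drop //; lia.
Qed.

Lemma perm_swapAt s p : 0 < p < size s -> perm_eq (swapAt s p) s.
Proof.
move=> /split_at[s1 [x [y [s2 [-> ->]]]]]; rewrite swapAt_cat perm_cat2l.
by apply/permP => a /=; rewrite addnCA.
Qed.

Lemma perm_foldl_swapAt s i :
  all (fun a => 0 < a < size s) i -> perm_eq (foldl swapAt s i) s.
Proof.
elim: i s => //= a i IHi s /andP[a_s i_s].
apply: perm_trans (perm_swapAt a_s); apply: IHi.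
by rewrite size_swapAt.
Qed.

Lemma size_foldl_swapAt s i : size (foldl swapAt s i) = size s.
Proof. by elim: i s => //= a i IHi s; rewrite IHi size_swapAt. Qed.

Lemma inv_count_cons x s :
  inv_count (x :: s) = count (fun y => y < x) s + inv_count s.
Proof.
rewrite /inv_count /= big_ord_recl /=; congr (_ + _).
  rewrite big_mkcond big_ord_recl /= add0n.
  rewrite -sum1_count [RHS](big_nth 0) big_mkord [RHS]big_mkcond /=.
  by apply: eq_bigr => q _; case: ifP.
apply: eq_bigr => p _; rewrite big_mkcond big_ord_recl /= add0n.
by rewrite [RHS]big_mkcond.
Qed.

Lemma inv_count_swap s1 x y s2 :
  inv_count (s1 ++ y :: x :: s2) + (y < x) =
  inv_count (s1 ++ x :: y :: s2) + (x < y).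
Proof.
elim: s1 => [|z s1 IH] /=; first by rewrite !inv_count_cons /=; lia.
by rewrite !inv_count_cons !count_cat /=; lia.
Qed.

Lemma inv_count_swapAt s p : 0 < p < size s ->
  inv_count (swapAt s p) <= inv_count s + (nth 0 s p.-1 < nth 0 s p).
Proof.
move=> /split_at[s1 [x [y [s2 [-> ->]]]]]; rewrite swapAt_cat /=.
rewrite !nth_cat ltnn (ltnNge (size s1).+1) leqnSn subnn subSnn /=.
by have := inv_count_swap s1 x y s2; lia.
Qed.

Lemma inv_count_foldl s i : all (fun a => 0 < a < size s) i ->
  inv_count (foldl swapAt s i) <= inv_count s + size i.
Proof.
elim: i s => /= [s _|a i IHi s /andP[a_s i_s]]; first by lia.
have := IHi (swapAt s a); rewrite size_swapAt => /(_ i_s).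
by have := inv_count_swapAt a_s; lia.
Qed.

Lemma inv_count_iota m n : inv_count (iota m n) = 0.
Proof.
elim: n m => [|n IHn] m /=; first by rewrite /inv_count big_ord0.
rewrite inv_count_cons IHn addn0; apply/eqP; rewrite -leqn0 leqNgt -has_count.
by apply/hasPn => y; rewrite mem_iota; lia.
Qed.

Lemma rev_iotaS m n : rev (iota m n.+1) = (m + n) :: rev (iota m n).
Proof. by rewrite -addn1 iotaD rev_cat. Qed.

Lemma NN_S n : NN n.+1 = NN n + n.+1.
Proof.
rewrite /NN; have -> : n.+1 * n.+2 = n.+1 * 2 + n * n.+1 by lia.
by rewrite divnMDl // addnC.
Qed.

Lemma NN_bin n : 'C(n.+1, 2) = NN n.
Proof. by rewrite bin2 /NN /= -divn2 mulnC. Qed.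

Lemma inv_count_rev_iota n : inv_count (rev (iota 1 n.+1)) = NN n.
Proof.
elim: n => [|n IHn]; first exact: (inv_count_iota 1 1).
rewrite rev_iotaS inv_count_cons IHn NN_S addnC; congr (_ + _).
rewrite count_rev; transitivity (size (iota 1 n.+1)); last by rewrite size_iota.
by apply/eqP; rewrite -all_count; apply/allP => y; rewrite mem_iota; lia.
Qed.

Lemma arr_size n i : arr n i (size i) = foldl swapAt (iota 1 n.+1) i.
Proof. by rewrite /arr take_size. Qed.

Lemma SigmaE n i : Sigma n i =
  [&& all (fun a => 0 < a <= n) i,
      foldl swapAt (iota 1 n.+1) i == rev (iota 1 n.+1) & size i == NN n].
Proof.
rewrite /Sigma arr_size; case: (all _ _) => //=.
by case: eqP => //= ->; rewrite inv_count_rev_iota.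
Qed.

Lemma Sigma_size n i : Sigma n i -> size i = NN n.
Proof. by rewrite SigmaE => /and3P[_ _ /eqP]. Qed.

Lemma Sigma_letters n i : Sigma n i -> all (fun a => 0 < a <= n) i.
Proof. by rewrite SigmaE => /and3P[]. Qed.

Lemma perm_state n u v : Sigma n (u ++ v) ->
  perm_eq (foldl swapAt (iota 1 n.+1) u) (iota 1 n.+1).
Proof.
move=> /Sigma_letters; rewrite all_cat => /andP[u_n _].
by apply: perm_foldl_swapAt; rewrite size_iota.
Qed.

(** A letter adds at most one inversion, and the length of the word equals the final number of
    inversions, so no letter can waste its step. *)
Lemma Sigma_ascend n u a v : Sigma n (u ++ a :: v) ->
  nth 0 (foldl swapAt (iota 1 n.+1) u) a.-1 < nth 0 (foldl swapAt (iota 1 n.+1) u) a.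
Proof.
set s := foldl _ _ u; move=> Si; have := Sigma_letters Si; rewrite all_cat /= => /and3P[u_n a_n v_n].
have sz_s : size s = n.+1 by rewrite size_foldl_swapAt size_iota.
have := @inv_count_foldl (iota 1 n.+1) u; rewrite size_iota inv_count_iota -/s.
move=> /(_ u_n) le_u.
have := @inv_count_foldl (swapAt s a) v; rewrite size_swapAt sz_s => /(_ v_n).
have := Si; rewrite SigmaE foldl_cat /= -/s => /and3P[_ /eqP-> /eqP sz_i].
rewrite inv_count_rev_iota -sz_i size_cat /=.
have := @inv_count_swapAt s a; rewrite sz_s => /(_ a_n).
by case: ltnP => //; lia.
Qed.

Lemma foldl_swapAt_rcons s x i : all (fun a => 0 < a < size s) i ->
  foldl swapAt (rcons s x) i = rcons (foldl swapAt s i) x.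
Proof.
elim: i s => //= a i IHi s /andP[a_s i_s].
rewrite -IHi ?size_swapAt //; congr foldl.
have [s1 [y [z [s2 [-> ->]]]]] := split_at a_s.
by rewrite swapAt_cat !rcons_cat /= swapAt_cat.
Qed.

Lemma foldl_swapAt_cons s x i : all (fun a => 0 < a < size s) i ->
  foldl swapAt (x :: s) (map succn i) = x :: foldl swapAt s i.
Proof.
elim: i s => //= a i IHi s /andP[a_s i_s].
rewrite -IHi ?size_swapAt //; congr foldl.
have [s1 [y [z [s2 [-> ->]]]]] := split_at a_s.
by rewrite swapAt_cat -[(size s1).+1]/(size (x :: s1)) -cat_cons swapAt_cat.
Qed.

Lemma foldl_swapAt_map_succn s i : all (fun a => 0 < a < size s) i ->
  foldl swapAt (map succn s) i = map succn (foldl swapAt s i).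
Proof.
elim: i s => //= a i IHi s /andP[a_s i_s].
rewrite -IHi ?size_swapAt //; congr foldl.
have [s1 [y [z [s2 [-> ->]]]]] := split_at a_s.
by rewrite swapAt_cat !map_cat /= -(size_map succn s1) swapAt_cat.
Qed.

(** Partial chains are needed to know the arrangement before each chain node, hence the two wires
    that meet there. *)
Lemma foldl_swapAt_iota s x r : r <= size s ->
  foldl swapAt (x :: s) (iota 1 r) = take r s ++ x :: drop r s.
Proof.
elim: r => [|r IHr] le_r; first by rewrite take0 drop0.
have -> : iota 1 r.+1 = iota 1 r ++ [:: r.+1] by rewrite -(addn1 r) iotaD add1n addn1.
rewrite foldl_cat IHr 1?ltnW //=.
rewrite (drop_nth 0) // (take_nth 0) // -cats1 -catA /=.
by have := swapAt_cat (take r s) x (nth 0 s r) (drop r.+1 s); rewrite (size_takel (ltnW le_r)).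
Qed.

Lemma foldl_swapAt_rev_iota s x r : r <= size s ->
  foldl swapAt (rcons s x) (take r (rev (iota 1 (size s)))) =
  take (size s - r) s ++ x :: drop (size s - r) s.
Proof.
elim: r => [|r IHr] le_r; first by rewrite take0 subn0 take_size drop_size cats1.
rewrite (take_nth 0) ?size_rev ?size_iota // -[rcons (take _ _) _]cats1 foldl_cat IHr 1?ltnW //=.
rewrite nth_rev ?size_iota // nth_iota; last by lia.
have -> : size s - r = (size s - r.+1).+1 by lia.
set q := size s - r.+1; have lt_q : q < size s by rewrite /q; lia.
rewrite (take_nth 0) // -[rcons (take _ _) _]cats1 -catA /= add1n.
have := swapAt_cat (take q s) (nth 0 s q) x (drop q.+1 s).
by rewrite size_takel ?(ltnW lt_q) // => ->; rewrite -drop_nth.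
Qed.

Lemma nth_swapAt s p q : q < size s ->
  nth 0 (swapAt s p) q =
  nth 0 s (if q == p.-1 then p else if q == p then p.-1 else q).
Proof. by move=> lt_q; rewrite (nth_map 0) ?size_iota // nth_iota. Qed.

(** * 2-moves and their effect on wires *)

Definition far (a b : nat) := (a.+1 < b) || (b.+1 < a).

Lemma farC a b : far a b = far b a.
Proof. by rewrite /far orbC. Qed.

Lemma nth_swapAt_far s a b : far a b -> 0 < a -> 0 < b < size s ->
  nth 0 (swapAt s a) b.-1 = nth 0 s b.-1 /\ nth 0 (swapAt s a) b = nth 0 s b.
Proof.
rewrite /far => far_ab a0 b_s.
by rewrite !nth_swapAt; do ?[case: eqP => [|_]]; try lia.
Qed.

Lemma swapAt_far s a b : far a b -> 0 < a < size s -> 0 < b < size s ->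
  swapAt (swapAt s a) b = swapAt (swapAt s b) a.
Proof.
rewrite /far => far_ab a_s b_s.
apply: (@eq_from_nth _ 0); rewrite !size_swapAt // => q lt_q.
rewrite !nth_swapAt ?size_swapAt //; repeat case: eqP => //; lia.
Qed.

Lemma foldl_two_move n u a b v : far a b ->
  all (fun a => 0 < a <= n) (u ++ a :: b :: v) ->
  foldl swapAt (iota 1 n.+1) (u ++ a :: b :: v) =
  foldl swapAt (iota 1 n.+1) (u ++ b :: a :: v).
Proof.
move=> far_ab; rewrite all_cat /= => /and4P[_ a_n b_n _].
by rewrite !foldl_cat /= swapAt_far // size_foldl_swapAt /= size_iota.
Qed.

Lemma two_move_sym w w' : two_move w w' -> two_move w' w.
Proof.
move=> [u [v [a [b [-> -> ab]]]]]; exists u, v, b, a; split=> //.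
by rewrite orbC.
Qed.

Lemma two_move_Sigma n w w' : two_move w w' -> Sigma n w -> Sigma n w'.
Proof.
move=> [u [v [a [b [-> -> ab]]]]]; rewrite !SigmaE => /and3P[w_n /eqP ew /eqP sz].
rewrite -(foldl_two_move ab) // ew eqxx -sz !size_cat /= eqxx !andbT.
by move: w_n; rewrite !all_cat /= => /and4P[-> -> -> ->].
Qed.

(** Since 2-moves are symmetric, one-sided invariance of [P] already gives an equivalence along the
    generated relation. *)
Lemma wsim_inv (P : seq nat -> Prop) :
    (forall w w', two_move w w' -> P w -> P w') ->
  forall w w', wsim w w' -> P w <-> P w'.
Proof.
move=> mP w w'; elim=> {w w'} [w w' m|w|w w' _ ->|w1 w2 w3 _ -> _ ->] //.
by split; apply: mP => //; apply: two_move_sym.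
Qed.

Lemma wsim_Sigma n w w' : wsim w w' -> Sigma n w <-> Sigma n w'.
Proof. apply: (wsim_inv (P := Sigma n)) => ? ?; exact: two_move_Sigma. Qed.

Lemma wsim_count w w' a : wsim w w' -> count_mem a w = count_mem a w'.
Proof.
move=> ww'; apply/(wsim_inv (P := fun w1 => count_mem a w = count_mem a w1) _ ww') => //.
move=> _ _ [u [v [b [c [-> -> _]]]]] ->.
by rewrite !count_cat /= (addnCA (b == a)).
Qed.

(* A 2-move never exchanges two letters of {a, a+1}. *)
Lemma wsim_filter w w' a : wsim w w' ->
  [seq x <- w | (x == a) || (x == a.+1)] = [seq x <- w' | (x == a) || (x == a.+1)].
Proof.
set p := fun _ => _ => ww'.
apply/(wsim_inv (P := fun w1 => filter p w = filter p w1) _ ww') => //.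
move=> _ _ [u [v [b [c [-> -> bc]]]]] ->; rewrite !filter_cat /=; congr (_ ++ _).
by rewrite /p; case: (b =P a); case: (b =P a.+1); case: (c =P a); case: (c =P a.+1) => //=; lia.
Qed.

Lemma wire_split n i j : 0 < j <= size i ->
  [/\ i = take j.-1 i ++ ix i j :: drop j i,
      wireU n i j = nth 0 (foldl swapAt (iota 1 n.+1) (take j.-1 i)) (ix i j).-1
    & wireL n i j = nth 0 (foldl swapAt (iota 1 n.+1) (take j.-1 i)) (ix i j)].
Proof.
case: j => // j lt_j; split=> //; rewrite /ix -drop_nth ?cat_take_drop //.
Qed.

Lemma ix_letter n i j : Sigma n i -> 0 < j <= NN n -> 0 < ix i j <= n.
Proof.
move=> Si j_i; have /all_nthP := Sigma_letters Si; apply.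
by rewrite (Sigma_size Si); lia.
Qed.

Lemma Sigma_wires n i j : Sigma n i -> 0 < j <= NN n ->
  0 < wireU n i j /\ wireU n i j < wireL n i j <= n.+1.
Proof.
move=> Si j_i; have := j_i; rewrite -(Sigma_size Si) => /(wire_split n)[ei -> ->].
rewrite ei in Si; have ps := perm_state Si.
rewrite (Sigma_ascend Si); set s := foldl _ _ _ in ps *.
have sz : size s = n.+1 by rewrite (perm_size ps) size_iota.
have := Sigma_letters Si; rewrite all_cat /= => /and3P[_ a_n _].
have ms q : q < n.+1 -> 0 < nth 0 s q < n.+2.
  by move=> lt_q; have := mem_nth 0 (s := s); rewrite sz => /(_ _ lt_q);
    rewrite (perm_mem ps) mem_iota.
have /andP[-> _] : 0 < nth 0 s (ix i j).-1 < n.+2 by apply: ms; lia.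
have /andP[_] : 0 < nth 0 s (ix i j) < n.+2 by apply: ms; lia.
by rewrite ltnS.
Qed.

(** The renumbering of nodes caused by a 2-move. Nodes are 1-based, so a move just behind a prefix
    [u] has [m = size u + 1]. *)
Definition node_swap (m l : nat) := if l == m then m.+1 else if l == m.+1 then m else l.

Lemma node_swapK m : involutive (node_swap m).
Proof. by move=> l; rewrite /node_swap; do ![case: eqP => //]; lia. Qed.

Lemma two_move_ix u a b v l : 0 < l ->
  ix (u ++ b :: a :: v) (node_swap (size u).+1 l) = ix (u ++ a :: b :: v) l.
Proof.
move=> l0; rewrite /ix /node_swap !nth_cat.
case: eqP => [->|ne1] /=; first by rewrite ltnn ltnNge leqnSn subnn subSnn.
case: eqP => [->|ne2] /=; first by rewrite ltnn ltnNge leqnSn subnn subSnn.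
case: ltnP => // ge; have -> : l.-1 - size u = (l.-1 - size u - 2).+2 by lia.
by [].
Qed.

(** Swaps at far letters commute and touch disjoint positions, so each of the two nodes keeps its
    wires and the later arrangements agree. *)
Lemma two_move_wires n u a b v l : far a b -> Sigma n (u ++ a :: b :: v) ->
  0 < l <= NN n ->
  let i' := u ++ b :: a :: v in let l' := node_swap (size u).+1 l in
  wireU n i' l' = wireU n (u ++ a :: b :: v) l /\
  wireL n i' l' = wireL n (u ++ a :: b :: v) l.
Proof.
move=> far_ab Si l_N i' l'; rewrite /wireU /wireL two_move_ix ?(andP l_N).1 // /i' /l' /node_swap /arr.
have:= Sigma_letters Si; rewrite all_cat /= => /and4P[u_n a_n b_n v_n].
set s := iota 1 n.+1; have sz : size (foldl swapAt s u) = n.+1.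
  by rewrite size_foldl_swapAt size_iota.
case: eqP => [->|ne1] /=.
  rewrite /ix /= !take_cat ltnn ltnNge leqnSn subnn subSnn /= ?cats0.
  rewrite foldl_cat /= nth_cat ltnn subnn /=.
  have [|||->->] // := @nth_swapAt_far (foldl swapAt s u) b a; rewrite ?sz 1?farC //; lia.
case: eqP => [->|ne2] /=.
  rewrite /ix /= !take_cat ltnn ltnNge leqnSn subnn subSnn /= ?cats0.
  rewrite foldl_cat /= nth_cat ltnNge leqnSn subSnn /=.
  have [|||->->] // := @nth_swapAt_far (foldl swapAt s u) a b; rewrite ?sz //; lia.
rewrite !take_cat; case: ltnP => // ge.
have -> : l.-1 - size u = (l.-1 - size u - 2).+2 by lia.
by rewrite /= !foldl_cat /= (swapAt_far far_ab) ?sz.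
Qed.

(** * Words that end with a chain *)

Lemma foldl_swapAt_D s x m : size s = m ->
  foldl swapAt (rcons s x) (rev (iota 1 m)) = x :: s.
Proof.
move=> <-; rewrite -[rev _]take_size size_rev size_iota foldl_swapAt_rev_iota //.
by rewrite subnn take0 drop0.
Qed.

Lemma foldl_swapAt_A s x m : size s = m ->
  foldl swapAt (x :: s) (iota 1 m) = rcons s x.
Proof.
by move=> <-; rewrite foldl_swapAt_iota // take_size drop_size cats1.
Qed.

(** The descending chain brings the last wire to the front and keeps the order of the others, so the
    known final arrangement can be read backwards. *)
Lemma Sigma_D_state n u : Sigma n.+1 (u ++ rev (iota 1 n.+1)) ->
  foldl swapAt (iota 1 n.+2) u = rcons (rev (iota 1 n.+1)) n.+2.
Proof.
rewrite SigmaE foldl_cat => /and3P[_ /eqP + _].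
have := size_foldl_swapAt (iota 1 n.+2) u; rewrite size_iota.
case/lastP: (foldl _ _ _) => // s x; rewrite size_rcons => -[sz].
by rewrite foldl_swapAt_D // rev_iotaS add1n => -[-> ->].
Qed.

Lemma Sigma_A_state n u : Sigma n.+1 (u ++ iota 1 n.+1) ->
  foldl swapAt (iota 1 n.+2) u = 1 :: rev (iota 2 n.+1).
Proof.
rewrite SigmaE foldl_cat => /and3P[_ /eqP + _].
have := size_foldl_swapAt (iota 1 n.+2) u; rewrite size_iota.
case: (foldl _ _ _) => // x s [sz].
rewrite foldl_swapAt_A // [iota 1 n.+2]/= -[2 :: _]/(iota 2 n.+1) rev_cons.
by move/rcons_inj => -[-> ->].
Qed.

(* Every crossing is increasing, so the largest wire never leaves the last
   position and comes back. *)
Lemma last_letters n u v : Sigma n.+1 (u ++ v) ->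
  last 0 (foldl swapAt (iota 1 n.+2) u) = n.+2 -> all (fun a => 0 < a <= n) u.
Proof.
elim/last_ind: u v => // u a IHu v; rewrite cat_rcons => Si.
have asc := Sigma_ascend Si; have ps := perm_state Si.
have := Sigma_letters Si; rewrite all_cat /= all_rcons => /and3P[_ a_n _].
rewrite -cats1 foldl_cat /=; move: asc ps; set s := foldl _ _ u => asc ps.
have sz : size s = n.+2 by rewrite (perm_size ps) size_iota.
have [|s1 [x [y [s2 [es ea]]]]] := @split_at s a; first by rewrite sz.
have le_y : y <= n.+2.
  have : y \in s by rewrite es mem_cat !inE eqxx !orbT.
  by rewrite (perm_mem ps) mem_iota; lia.
move: asc sz; rewrite es ea swapAt_cat !nth_cat /= ltnn (ltnNge (size s1).+1) leqnSn.
rewrite subnn subSnn /= size_cat /= last_cat /=.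
case: s2 es => [|z s2] es lt_xy sz el; first by move: el lt_xy le_y => /=; lia.
rewrite (IHu _ Si) ?andbT; last by rewrite -/s es last_cat.
by move: sz => /=; lia.
Qed.

(** Mirror image of [last_letters]: crossings move wire 1 only to the right, so if it still stands
    first after [u], no letter of [u] has touched the first position. *)
Lemma head_letters n u v : Sigma n.+1 (u ++ v) ->
  head 0 (foldl swapAt (iota 1 n.+2) u) = 1 -> all (fun a => 1 < a <= n.+1) u.
Proof.
elim/last_ind: u v => // u a IHu v; rewrite cat_rcons => Si.
have asc := Sigma_ascend Si; have ps := perm_state Si.
have := Sigma_letters Si; rewrite all_cat /= all_rcons => /and3P[_ a_n _].
rewrite -cats1 foldl_cat /=; move: asc ps; set s := foldl _ _ u => asc ps.
have sz : size s = n.+2 by rewrite (perm_size ps) size_iota.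
have [|s1 [x [y [s2 [es ea]]]]] := @split_at s a; first by rewrite sz.
have le_x : 0 < x.
  have : x \in s by rewrite es mem_cat !inE eqxx !orbT.
  by rewrite (perm_mem ps) mem_iota; lia.
move: asc sz; rewrite es ea swapAt_cat !nth_cat /= ltnn (ltnNge (size s1).+1) leqnSn.
rewrite subnn subSnn /= size_cat /=.
case: s1 es ea => [|z s1] es ea /= lt_xy sz el; first by move: el lt_xy le_x; lia.
rewrite (IHu _ Si) ?andbT; last by rewrite -/s es.
by lia.
Qed.

Lemma iotaSr m n : iota m n.+1 = rcons (iota m n) (m + n).
Proof. by rewrite -[n.+1]addn1 iotaD cats1. Qed.

Lemma Sigma_D n u : Sigma n.+1 (u ++ rev (iota 1 n.+1)) -> Sigma n u.
Proof.
move=> Si; have st := Sigma_D_state Si.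
have u_n : all (fun a => 0 < a <= n) u.
  by apply: (last_letters Si); rewrite st last_rcons.
have sz := Sigma_size Si; rewrite size_cat size_rev size_iota NN_S in sz.
rewrite SigmaE u_n (addIn sz) eqxx andbT /=; apply/eqP.
apply: (@rcons_injl _ n.+2); rewrite -st -foldl_swapAt_rcons; last by rewrite /= size_iota.
by rewrite -(iotaSr 1 n.+1).
Qed.

Lemma Sigma_A n u : Sigma n.+1 (u ++ iota 1 n.+1) ->
  u = map succn (map predn u) /\ Sigma n (map predn u).
Proof.
move=> Si; have st := Sigma_A_state Si.
have u_n : all (fun a => 1 < a <= n.+1) u.
  by apply: (head_letters Si); rewrite st.
have eu : u = map succn (map predn u).
  rewrite -map_comp -[LHS]map_id; apply/eq_in_map => a /(allP u_n) /=; lia.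
split=> //.
have u_n' : all (fun a => 0 < a <= n) (map predn u).
  by rewrite all_map; apply/allP => a /(allP u_n) /=; lia.
have sz := Sigma_size Si; rewrite size_cat size_iota NN_S in sz.
rewrite SigmaE u_n' size_map (addIn sz) eqxx andbT /=; apply/eqP.
have /(congr1 behead) : 1 :: foldl swapAt (iota 2 n.+1) (map predn u) = 1 :: rev (iota 2 n.+1).
  by rewrite -st {2}eu -[iota 1 n.+2]/(1 :: iota 2 n.+1) foldl_swapAt_cons ?size_iota.
have e2 : iota 2 n.+1 = map succn (iota 1 n.+1) by exact: (iotaDl 1 1).
rewrite /behead e2 foldl_swapAt_map_succn; last by rewrite size_iota.
by rewrite -map_rev; apply/inj_map/succn_inj.
Qed.

Lemma Sigma_D_wires n u (i := u ++ rev (iota 1 n.+1)) : Sigma n.+1 i ->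
  (forall j, 0 < j <= NN n -> [/\ ix i j = ix u j,
     wireU n.+1 i j = wireU n u j & wireL n.+1 i j = wireL n u j]) /\
  (forall r, 0 < r <= n.+1 -> [/\ ix i (NN n + r) = n.+2 - r,
     wireU n.+1 i (NN n + r) = r & wireL n.+1 i (NN n + r) = n.+2]).
Proof.
move=> Si; have Su := Sigma_D Si; have st := Sigma_D_state Si.
have szu := Sigma_size Su; split=> [j j_u|r r_n].
  have Eix : ix i j = ix u j by rewrite /ix nth_cat szu; case: ltnP => //; lia.
  have Ea : arr n.+1 i j.-1 = rcons (arr n u j.-1) n.+2.
    rewrite /arr takel_cat ?szu; last by lia.
    rewrite -foldl_swapAt_rcons; first by rewrite -(iotaSr 1 n.+1).
    rewrite size_iota; apply/allP => a /mem_take /(allP (Sigma_letters Su)) //.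
  have sza : size (arr n u j.-1) = n.+1 by rewrite /arr size_foldl_swapAt size_iota.
  have ij := ix_letter Su j_u.
  by split=> //; rewrite /wireU /wireL Eix Ea nth_rcons sza; case: ltnP => //; lia.
have Eix : ix i (NN n + r) = n.+2 - r.
  rewrite /ix nth_cat szu; case: ltnP => [|_]; first by lia.
  by rewrite nth_rev ?size_iota ?nth_iota; lia.
(* After [r-1] chain letters wire [n+2] has passed wires [1, ..., r-1], which now stand to its
   right; its left neighbour is wire [r]. *)
have Ea : arr n.+1 i (NN n + r).-1 =
    rev (iota r (n.+2 - r)) ++ n.+2 :: rev (iota 1 r.-1).
  rewrite /arr take_cat szu; case: ltnP => [|_]; first by lia.
  rewrite foldl_cat st.
  have := @foldl_swapAt_rev_iota (rev (iota 1 n.+1)) n.+2 ((NN n + r).-1 - NN n).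
  rewrite size_rev size_iota => ->; last by lia.
  rewrite take_rev drop_rev size_iota drop_iota take_iota.
  by congr (rev (iota _ _) ++ _ :: rev (iota _ _)); lia.
split=> //; rewrite /wireU /wireL Eix Ea nth_cat size_rev size_iota.
  case: ltnP => [_|]; last by lia.
  by rewrite nth_rev ?size_iota ?nth_iota; lia.
by rewrite ltnn subnn.
Qed.

Lemma Sigma_A_wires n u (i := map succn u ++ iota 1 n.+1) : Sigma n.+1 i -> Sigma n u ->
  (forall j, 0 < j <= NN n -> [/\ ix i j = (ix u j).+1,
     wireU n.+1 i j = (wireU n u j).+1 & wireL n.+1 i j = (wireL n u j).+1]) /\
  (forall r, 0 < r <= n.+1 -> [/\ ix i (NN n + r) = r,
     wireU n.+1 i (NN n + r) = 1 & wireL n.+1 i (NN n + r) = n.+3 - r]).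
Proof.
move=> Si Su; have st := Sigma_A_state Si.
have szu := Sigma_size Su; split=> [j j_u|r r_n].
  have Eix : ix i j = (ix u j).+1.
    rewrite /ix nth_cat size_map szu; case: ltnP => [lt_j|]; last by lia.
    by rewrite (nth_map 0) // szu.
  have Ea : arr n.+1 i j.-1 = 1 :: map succn (arr n u j.-1).
    have le_u : all (fun a => 0 < a < size (iota 1 n.+1)) (take j.-1 u).
      by rewrite size_iota; apply/allP => a /mem_take /(allP (Sigma_letters Su)).
    rewrite /arr takel_cat ?size_map ?szu; last by lia.
    rewrite -foldl_swapAt_map_succn // -foldl_swapAt_cons ?size_map // map_take.
    by rewrite -(iotaDl 1 1).
  have sza : size (arr n u j.-1) = n.+1 by rewrite /arr size_foldl_swapAt size_iota.
  have ij := ix_letter Su j_u.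
  have lt_ix : ix u j < size (arr n u j.-1) by rewrite sza; case/andP: ij.
  split=> //; rewrite /wireU /wireL Eix Ea -?pred_Sn; last by rewrite /= (nth_map 0).
  case: (ix u j) ij lt_ix => // q _ lt_q.
  by rewrite /= (nth_map 0) //; apply: ltnW.
have Eix : ix i (NN n + r) = r.
  rewrite /ix nth_cat size_map szu; case: ltnP => [|_]; first by lia.
  by rewrite nth_iota; lia.
(* After [r-1] chain letters wire 1 has passed wires [n+2, ..., n+4-r]; its right neighbour is wire
   [n+3-r]. *)
have Ea : arr n.+1 i (NN n + r).-1 =
    rev (iota (n.+4 - r) r.-1) ++ 1 :: rev (iota 2 (n.+2 - r)).
  rewrite /arr take_cat size_map szu; case: ltnP => [|_]; first by lia.
  rewrite foldl_cat st take_iota foldl_swapAt_iota; last first.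
    by rewrite size_rev size_iota; lia.
  rewrite take_rev drop_rev size_iota drop_iota take_iota.
  by congr (rev (iota _ _) ++ _ :: rev (iota _ _)); lia.
split=> //; rewrite /wireU /wireL Eix Ea nth_cat size_rev size_iota.
  by rewrite ltnn subnn.
case: ltnP => [|_]; first by lia.
have -> : r - r.-1 = 1 by lia.
by rewrite /= nth_rev ?size_iota ?nth_iota; lia.
Qed.

(** * Vanishing index forces an empty tail in every decomposition *)

Lemma cat2_nil (a b : nat) s s' v : a != b -> all (pred1 a) v ->
  s ++ [:: b; a] ++ v = s' ++ [:: b; a] -> v = [::].
Proof.
move=> ne_ab; rewrite -all_rev => a_v /(congr1 rev); rewrite !rev_cat /=.
suff H : forall w, all (pred1 a) w ->
    (w ++ rev [:: b; a]) ++ rev s = rev [:: b; a] ++ rev s' -> w = [::].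
  by move=> /(H _ a_v) /(congr1 rev); rewrite revK.
move=> {v a_v} w.
case: w => [//|x [|y r]] /=.
  by move=> _ [_ /eqP]; rewrite (negbTE ne_ab).
by case/and3P => _ /eqP-> _ [_ /eqP]; rewrite (negbTE ne_ab).
Qed.

Lemma filter_iota2 n a : 0 < a <= n ->
  [seq x <- iota 1 n.+1 | (x == a) || (x == a.+1)] = [:: a; a.+1].
Proof.
set p := fun _ => _; move=> a_n.
have nil m k : (m + k <= a) || (a.+1 < m) -> filter p (iota m k) = [::].
  move=> out; rewrite -(filter_pred0 (iota m k)); apply: eq_in_filter => x.
  by rewrite mem_iota /p /=; lia.
have -> : iota 1 n.+1 = iota 1 a.-1 ++ iota a 2 ++ iota (a + 2) (n - a).
  by rewrite -iotaD -{2}(_ : 1 + a.-1 = a) -?iotaD; [congr (iota _ _)|]; lia.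
rewrite !filter_cat (nil 1 a.-1) ?(nil (a + 2)); [|lia|lia].
by rewrite /= /p !eqxx orbT.
Qed.

Lemma all_filter1 (a b : nat) v : b \notin v ->
  all (pred1 a) [seq x <- v | (x == a) || (x == b)].
Proof.
move=> bv; apply/allP => x; rewrite mem_filter => /andP[/orP[//|/eqP->]].
by rewrite (negbTE bv).
Qed.

Lemma seq_nil (n : nat) v : all (fun a => 0 < a <= n) v ->
  (forall a, 0 < a <= n -> a \notin v) -> v = [::].
Proof.
case: v => // a v /andP[a_n _] /(_ a a_n).
by rewrite inE eqxx.
Qed.

(** The letter [n+1] occurs only once, inside the chain, so it is not in [v]. If [a+1] is missing
    from [v], compare the subwords in the letters [a] and [a+1]: one ends with [a+1, a], so the
    other cannot have further letters [a] behind its chain. *)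
Lemma ind0_D n w u v u' : Sigma n.+1 w ->
  wsim w (u ++ rev (iota 1 n.+1) ++ v) -> wsim w (u' ++ rev (iota 1 n.+1)) ->
  v = [::].
Proof.
move=> Sw wv wu'.
have Sv := (wsim_Sigma n.+1 wv).1 Sw; have Su' := (wsim_Sigma n.+1 wu').1 Sw.
have /allP u'_n := Sigma_letters (Sigma_D Su').
have v_n : n.+1 \notin v.
  have nu' : count_mem n.+1 u' = 0.
    by apply/count_memPn/negP => /u'_n; lia.
  have := wsim_count n.+1 wv; rewrite (wsim_count n.+1 wu').
  by rewrite !count_cat nu' => e; apply/count_memPn; lia.
have H d : d <= n -> n.+1 - d \notin v.
  elim: d => [|d IHd] lt_d; first by rewrite subn0.
  have {}IHd := IHd (ltnW lt_d); set a := n.+1 - d.+1.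
  have ea : n.+1 - d = a.+1 by rewrite /a; lia.
  rewrite ea in IHd.
  have := wsim_filter a wv; rewrite (wsim_filter a wu') !filter_cat filter_rev.
  rewrite filter_iota2 ?{1}/a; last by rewrite /a; lia.
  move/esym/cat2_nil => /(_ (negbT (ltn_eqF (ltnSn a))) (all_filter1 _ IHd)) ev.
  apply/negP => av; have : a \in [seq x <- v | (x == a) || (x == a.+1)].
    by rewrite mem_filter eqxx.
  by rewrite ev.
apply: (@seq_nil n.+1) => [|a a_n].
  by have := Sigma_letters Sv; rewrite !all_cat => /and3P[].
by have := H (n.+1 - a); rewrite subKn; [apply; lia | lia].
Qed.

(** The same argument with the letters taken upwards from 1, which is absent from [u'] because that
    word is a shift. *)
Lemma ind0_A n w u v u' : Sigma n.+1 w ->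
  wsim w (u ++ iota 1 n.+1 ++ v) -> wsim w (u' ++ iota 1 n.+1) -> v = [::].
Proof.
move=> Sw wv wu'.
have Sv := (wsim_Sigma n.+1 wv).1 Sw; have Su' := (wsim_Sigma n.+1 wu').1 Sw.
have [eu' Su0] := Sigma_A Su'.
have v_1 : 1 \notin v.
  have nu' : count_mem 1 u' = 0.
    apply/count_memPn/negP; rewrite eu' => /mapP[x /(allP (Sigma_letters Su0))]; lia.
  have := wsim_count 1 wv; rewrite (wsim_count 1 wu').
  by rewrite !count_cat nu' => e; apply/count_memPn; lia.
have H d : d <= n -> d.+1 \notin v.
  elim: d => [//|d IHd] lt_d; have {}IHd := IHd (ltnW lt_d).
  have := wsim_filter d.+1 wv; rewrite (wsim_filter d.+1 wu') !filter_cat.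
  rewrite filter_iota2 //.
  under [X in _ ++ _ ++ X]eq_filter => x do rewrite orbC.
  move/esym/cat2_nil => /(_ (negbT (gtn_eqF (ltnSn d.+1))) (all_filter1 _ IHd)) ev.
  apply/negP => av; have : d.+2 \in [seq x <- v | (x == d.+2) || (x == d.+1)].
    by rewrite mem_filter eqxx.
  by rewrite ev.
apply: (@seq_nil n.+1) => [|[//|a] a_n]; last exact: H.
by have := Sigma_letters Sv; rewrite !all_cat => /and3P[].
Qed.

(** * Rigorous paths *)

Arguments seg_dir : simpl never.

(** A word enters the notion of a path only through the wires [U j] and [L j] at each node; with
    these as parameters, diagrams can be truncated and relabelled without exhibiting a word for
    them. *)
Definition on_node (U L : nat -> nat) (w j : nat) : bool := (w == U j) || (w == L j).

Definition other_wire (U L : nat -> nat) (w j : nat) : nat := if w == U j then L j else U j.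

Definition through (U L : nat -> nat) (k w l : nat) : bool :=
  ~~ [&& ~~ up k w, ~~ up k (other_wire U L w l) & other_wire U L w l < w] &&
  ~~ [&& up k w, up k (other_wire U L w l) & w < other_wire U L w l].

Definition inner (N : nat) (U L : nat -> nat) (a b w : nat) : seq nat :=
  [seq l <- iota 1 N | on_node U L w l && (minn a b < l < maxn a b)].

(* As in Defs, [N.+1] is the bottom end of every wire; the path has reached node [a]
   and leaves it on wire [w]. *)
Fixpoint walk (N : nat) (U L : nat -> nat) (k a w : nat) (p : seq (nat * nat)) : bool :=
  if p is (j, w') :: p' then
    [&& 0 < j <= N, on_node U L w j, w' == other_wire U L w j, seg_dir k (a, j, w),
        all (through U L k w) (inner N U L a j w) & walk N U L k j w' p']
  else seg_dir k (a, N.+1, w) && all (through U L k w) (inner N U L a N.+1 w).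

(** Kept apart from [walk] because passing each node at most once is a global condition, not
    checkable switch by switch. *)
Fixpoint visits (N : nat) (U L : nat -> nat) (a w : nat) (p : seq (nat * nat)) : seq nat :=
  if p is (j, w') :: p' then inner N U L a j w ++ visits N U L j w' p'
  else inner N U L a N.+1 w.

Definition rig_path (N : nat) (U L : nat -> nat) (k : nat) (p : seq (nat * nat)) : bool :=
  [&& walk N U L k N.+1 k p, last k (map snd p) == k.+1
    & uniq (map fst p ++ visits N U L N.+1 k p)].

Lemma rigorousE n i k p : rigorous n i k p = rig_path (NN n) (wireU n i) (wireL n i) k p.
Proof.
rewrite /rigorous /rig_path /segs.
set N := NN n; set U := wireU n i; set L := wireL n i.
pose sg a w (p : seq (nat * nat)) : seq (nat * nat * nat) := [seq ((x.1, x.2.1), x.2.2) |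
  x <- zip (a :: map fst p) (zip (rcons (map fst p) N.+1) (w :: map snd p))].
have sg0 a w : sg a w [::] = [:: (a, N.+1, w)] by [].
have sgS a w j w' q : sg a w ((j, w') :: q) = (a, j, w) :: sg j w' q by [].
have okE a b w : seg_ok n i k (a, b, w) = all (through U L k w) (inner N U L a b w) by [].
have Ew a w q : walk N U L k a w q =
    [&& all (switch_ok n i) (zip (w :: map snd q) q),
        all (seg_dir k) (sg a w q) & all (seg_ok n i k) (sg a w q)].
  elim: q a w => [|[j w'] q IHq] a w.
    by rewrite sg0 /= !andbT; exact: erefl.
  set b1 := 0 < j <= N; set b2 := on_node U L w j; set b3 := w' == other_wire U L w j.
  set b4 := seg_dir k (a, j, w); set b5 := all (through U L k w) (inner N U L a j w).
  set c1 := all (switch_ok n i) (zip (w' :: map snd q) q).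
  set c2 := all (seg_dir k) (sg j w' q); set c3 := all (seg_ok n i k) (sg j w' q).
  transitivity [&& b1, b2, b3, b4, b5 & walk N U L k j w' q]; first exact: erefl.
  transitivity [&& [&& b1, b2 & b3] && c1, b4 && c2 & b5 && c3]; last exact: erefl.
  rewrite IHq -/c1 -/c2 -/c3.
  clearbody b1 b2 b3 b4 b5 c1 c2 c3; clear; case: b1 b2 b3 b4 b5 c1 c2 c3 => [] [] [] [] [] [] [] [] //.
have Ev a w q : visits N U L a w q = flatten (map (seg_inner n i) (sg a w q)).
  elim: q a w => [|[j w'] q IHq] a w; first by rewrite sg0 /= cats0.
  by rewrite sgS /= IHq.
rewrite Ew Ev -/(sg N.+1 k p); case: (all (switch_ok n i) _) => //=.
by case: (all (seg_dir k) _) => /=; rewrite ?andbF //; case: (all (seg_ok n i k) _); rewrite /= ?andbF.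
Qed.

Lemma walk_nodes N U L k a w p : walk N U L k a w p ->
  all (fun x => 0 < x.1 <= N) p.
Proof. by elim: p a w => //= -[j w'] p IHp a w /and5P[-> _ _ _ /andP[_ /IHp]]. Qed.

Lemma walk_wires (W : pred nat) N U L k a w p :
  (forall l, 0 < l <= N -> W (U l) && W (L l)) ->
  walk N U L k a w p -> all (fun x => W x.2) p.
Proof.
move=> hW; elim: p a w => //= -[j w'] p IHp a w /=.
case/and5P=> /hW/andP[WU WL] _ /eqP-> _ /andP[_ /IHp ->].
by rewrite andbT /other_wire; case: ifP.
Qed.

(** * Renumbering nodes and renaming wires *)

Section Relabel.

Variables (N : nat) (U L U' L' : nat -> nat) (f g : nat -> nat) (k k' : nat) (W : pred nat).
Hypotheses (fK : involutive f) (fN : f N.+1 = N.+1).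
Hypothesis f_node : forall l, 0 < l <= N -> 0 < f l <= N.
Hypothesis wire_f : forall l, 0 < l <= N -> U' (f l) = g (U l) /\ L' (f l) = g (L l).
Hypothesis W_node : forall l, 0 < l <= N -> W (U l) && W (L l).
Hypothesis g_mono : forall x y, W x -> W y -> (g x < g y) = (x < y).
Hypotheses (Wk : W k) (gk : g k = k') (Wk1 : W k.+1) (gk1 : g k.+1 = k'.+1).

(** The nodes on wire [w], with its bottom end. Order is compared only within such a set, because a
    2-move reverses two nodes that lie on disjoint pairs of wires. *)
Let nd w l := (l == N.+1) || ((0 < l <= N) && on_node U L w l).

Hypothesis f_mono : forall w l l', nd w l -> nd w l' -> (f l < f l') = (l < l').

Let g_eq x y : W x -> W y -> (g x == g y) = (x == y).
Proof.
move=> Wx Wy; apply/eqP/eqP => [e|-> //].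
have := g_mono Wx Wy; have := g_mono Wy Wx; rewrite e ltnn; lia.
Qed.

Let on_f w l : W w -> 0 < l <= N -> on_node U' L' (g w) (f l) = on_node U L w l.
Proof.
move=> Ww hl; have [eU eL] := wire_f hl; have /andP[WU WL] := W_node hl.
by rewrite /on_node eU eL !g_eq.
Qed.

Let oth_f w l : W w -> 0 < l <= N -> other_wire U' L' (g w) (f l) = g (other_wire U L w l).
Proof.
move=> Ww hl; have [eU eL] := wire_f hl; have /andP[WU WL] := W_node hl.
by rewrite /other_wire eU eL g_eq //; case: ifP.
Qed.

Let W_oth w l : 0 < l <= N -> W (other_wire U L w l).
Proof. by move=> /W_node/andP[]; rewrite /other_wire; case: ifP. Qed.

Let up_g w : W w -> up k' (g w) = up k w.
Proof. by move=> Ww; rewrite /up leqNgt -gk g_mono // -leqNgt. Qed.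

Let through_f w l : W w -> 0 < l <= N ->
  through U' L' k' (g w) (f l) = through U L k w l.
Proof.
move=> Ww hl; have Wo := W_oth w hl.
by rewrite /through oth_f // !up_g // !g_mono.
Qed.

Let dir_f a b w : W w -> nd w a -> nd w b ->
  seg_dir k' (f a, f b, g w) = seg_dir k (a, b, w).
Proof. by move=> Ww na nb; rewrite /seg_dir up_g // !(f_mono (w := w)). Qed.

Let inner_f a b w : W w -> nd w a -> nd w b ->
  perm_eq (inner N U' L' (f a) (f b) (g w)) (map f (inner N U L a b w)).
Proof.
move=> Ww na nb; apply: uniq_perm; rewrite ?(map_inj_uniq (inv_inj fK)) ?filter_uniq ?iota_uniq //.
move=> x; rewrite -[x]fK (mem_map (inv_inj fK)); set l := f x.
rewrite !mem_filter !mem_iota !add1n !ltnS.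
have [hl|hl] := boolP (0 < l <= N); last first.
  rewrite andbF; apply/negbTE; apply: contra hl => /andP[_ /f_node].
  by rewrite fK.
rewrite f_node // andbT on_f //; case onl: (on_node U L w l) => //=.
have nl : nd w l by rewrite /nd hl onl orbT.
by rewrite !gtn_min !leq_max !(f_mono (w := w)) // andbT.
Qed.

Let all_inner_f a b w : W w -> nd w a -> nd w b ->
  all (through U L k w) (inner N U L a b w) ->
  all (through U' L' k' (g w)) (inner N U' L' (f a) (f b) (g w)).
Proof.
move=> Ww na nb /allP h; rewrite (perm_all _ (inner_f Ww na nb)) all_map.
apply/allP => l hl /=; rewrite through_f //; first exact: h.
by move: hl; rewrite mem_filter mem_iota => /andP[_]; rewrite add1n ltnS.
Qed.

Let h (x : nat * nat) := (f x.1, g x.2).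

Let walk_f p a w : W w -> nd w a -> walk N U L k a w p ->
  walk N U' L' k' (f a) (g w) (map h p) /\
  perm_eq (visits N U' L' (f a) (g w) (map h p)) (map f (visits N U L a w p)).
Proof.
have nE w0 : nd w0 N.+1 by rewrite /nd eqxx.
elim: p a w => [|[j w'] p IHp] a w Ww na /=.
  case/andP=> dir thr; move: (inner_f Ww na (nE w)) (dir_f Ww na (nE w)).
  by move: (all_inner_f Ww na (nE w) thr); rewrite fN dir => -> -> ->.
case/and5P=> hj onj /eqP-> dir /andP[thr wk].
have nj : nd w j by rewrite /nd hj onj orbT.
have Wo := W_oth w hj.
have no : nd (other_wire U L w j) j.
  by rewrite /nd hj /on_node /other_wire; case: ifP; rewrite eqxx !orbT.
have [wk' pv'] := IHp _ _ Wo no wk.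
by rewrite f_node // on_f // onj oth_f // eqxx dir_f // dir all_inner_f // map_cat perm_cat // inner_f.
Qed.

(** Orientations, directions of segments and the rule for going straight compare only wire labels
    and nodes on a common wire, so monotonicity of [g] on [W] and of [f] along each wire
    suffices. *)
Lemma rig_relabel p : rig_path N U L k p -> rig_path N U' L' k' (map h p).
Proof.
case/and3P=> wk /eqP el un; have nE : nd k N.+1 by rewrite /nd eqxx.
have [wk' pv'] := walk_f Wk nE wk; rewrite fN gk in wk' pv'.
rewrite /rig_path wk' -gk -map_comp (map_comp g snd) last_map el gk1 gk eqxx /=.
rewrite -map_comp (map_comp f fst).
rewrite (perm_uniq (_ : perm_eq _ (map f (map fst p ++ visits N U L N.+1 k p)))).
  by rewrite (map_inj_uniq (inv_inj fK)).
by rewrite map_cat perm_cat2l.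
Qed.

End Relabel.

Lemma inner_sym N U L a b w : inner N U L a b w = inner N U L b a w.
Proof. by rewrite /inner minnC maxnC. Qed.

Lemma mem_inner N U L a b w l : (l \in inner N U L a b w) =
  [&& 0 < l <= N, on_node U L w l & minn a b < l < maxn a b].
Proof. by rewrite mem_filter mem_iota add1n ltnS andbC. Qed.

Lemma inner_nil N U L a b w :
  (forall l, 0 < l <= N -> on_node U L w l -> minn a b < l < maxn a b -> False) ->
  inner N U L a b w = [::].
Proof.
move=> h; case e : (inner _ _ _ _ _ _) => [//|l s]; exfalso.
have : l \in inner N U L a b w by rewrite e inE eqxx.
by rewrite mem_inner => /and3P[]; apply: h.
Qed.

Lemma inner_succ N U L a w : inner N U L a a.+1 w = [::].
Proof. by apply: inner_nil => l _ _; lia. Qed.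

(** * Adding nodes below a diagram *)

Section Extension.

Variables (N M : nat) (U L : nat -> nat) (k : nat) (W : pred nat).
Hypothesis le_NM : N <= M.
Hypothesis W_node : forall l, 0 < l <= N -> W (U l) && W (L l).
Hypothesis W_through : forall w l, W w -> N < l <= M -> on_node U L w l -> through U L k w l.

Let X w := [seq l <- iota N.+1 (M - N) | on_node U L w l].

Let mem_X w l : (l \in X w) = (N < l <= M) && on_node U L w l.
Proof. by rewrite mem_filter mem_iota andbC; congr andb; lia. Qed.

Let iota_NM : iota 1 M = iota 1 N ++ iota N.+1 (M - N).
Proof. by rewrite -[N.+1]add1n -iotaD subnKC. Qed.

Let inner_mid a b w : a <= N -> b <= N -> inner M U L a b w = inner N U L a b w.
Proof.
move=> aN bN; rewrite /inner iota_NM filter_cat -[RHS]cats0; congr cat.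
apply/eqP; rewrite -size_eq0 size_filter -leqn0 leqNgt -has_count.
by apply/hasPn => l; rewrite mem_iota; apply: contraTN => /andP[_]; lia.
Qed.

Let inner_last a w : a <= N -> inner M U L a M.+1 w = inner N U L a N.+1 w ++ X w.
Proof.
move=> aN; rewrite /inner iota_NM filter_cat; congr cat; apply: eq_in_filter => l.
  by rewrite mem_iota => hl; congr andb; lia.
by rewrite mem_iota => hl; rewrite -[RHS]andbT; congr andb; lia.
Qed.

Let all_X w : W w -> all (through U L k w) (X w).
Proof. by move=> Ww; apply/allP => l; rewrite mem_X => /andP[]; apply: W_through. Qed.

Let W_oth w l : 0 < l <= N -> W (other_wire U L w l).
Proof. by move=> /W_node/andP[]; rewrite /other_wire; case: ifP. Qed.

Let dir_bottom a w : a <= N -> seg_dir k (a, M.+1, w) = seg_dir k (a, N.+1, w).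
Proof. by rewrite /seg_dir => aN; case: ifP => _; lia. Qed.

Let dir_top a w : a <= N -> seg_dir k (M.+1, a, w) = seg_dir k (N.+1, a, w).
Proof. by rewrite /seg_dir => aN; case: ifP => _; lia. Qed.

Let walk_ext p a w : a <= N -> W w -> all (fun x => x.1 <= N) p ->
  walk M U L k a w p = walk N U L k a w p.
Proof.
elim: p a w => [|[j w'] p IHp] a w aN Ww /=.
  by rewrite dir_bottom // inner_last // all_cat all_X // andbT.
case/andP=> jN pN; rewrite (leq_trans jN le_NM) jN; apply: andb_id2l => /andP[j0 _].
apply: andb_id2l => _; apply: andb_id2l => /eqP->.
by rewrite inner_mid // IHp // W_oth // j0.
Qed.

Let visits_ext p a w : a <= N -> all (fun x => x.1 <= N) p ->
  visits M U L a w p = visits N U L a w p ++ X (last w (map snd p)).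
Proof.
elim: p a w => [|[j w'] p IHp] a w aN /=; first by rewrite inner_last.
by case/andP=> jN pN; rewrite inner_mid // IHp // catA.
Qed.

Hypotheses (Wk : W k) (X_disj : forall l, N < l <= M -> on_node U L k l -> on_node U L k.+1 l -> False).

(** If all switches lie among the first [N] nodes, the new nodes are met only on the first segment,
    along wire [k], and on the last, along wire [k+1]. Both go straight there, which [W_through]
    permits, and [X_disj] excludes a repeated node. *)
Lemma rig_ext p : all (fun x => x.1 <= N) p -> rig_path M U L k p = rig_path N U L k p.
Proof.
case: p => [|[j w'] p].
  by move=> _; rewrite /rig_path /= (ltn_eqF (ltnSn k)) !andbF.
move=> pN; have /= /andP[jN pN'] := pN; rewrite /rig_path; congr andb.
  rewrite /= (leq_trans jN le_NM) jN; apply: andb_id2l => /andP[j0 _].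
  apply: andb_id2l => _; apply: andb_id2l => /eqP->.
  rewrite dir_top // inner_sym inner_last // all_cat all_X // andbT inner_sym.
  by rewrite walk_ext // W_oth // j0.
apply: andb_id2l => /eqP el.
have {}el : last w' (map snd p) = k.+1 := el.
rewrite -[map fst (_ :: _)]/(j :: map fst p).
rewrite -[visits M _ _ _ _ _]/(inner M U L M.+1 j k ++ visits M U L j w' p).
rewrite -[visits N _ _ _ _ _]/(inner N U L N.+1 j k ++ visits N U L j w' p).
rewrite inner_sym inner_last // inner_sym visits_ext // el.
set V1 := inner _ _ _ _ _ _; set V2 := visits _ _ _ _ _ _; set P := map fst p.
rewrite (perm_uniq (_ : perm_eq _ ((j :: P ++ V1 ++ V2) ++ X k ++ X k.+1))); last first.
  by apply/permP => a; rewrite !count_cat /= !count_cat; lia.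
have lowN : {in j :: P ++ V1 ++ V2, forall l, l <= N}.
  move=> l; rewrite inE !mem_cat => /or4P[/eqP->//||/[!mem_inner]/and3P[/andP[]]//|].
    by case/mapP=> x /(allP pN') ? ->.
  rewrite /V2; elim: (p) (j) (w') => [|[j2 w2] q IHq] a w /=.
    by rewrite mem_inner => /and3P[/andP[]].
  by rewrite mem_cat => /orP[|/IHq//]; rewrite mem_inner => /and3P[/andP[]].
rewrite cat_uniq -[RHS]andbT; apply: andb_id2l => _.
have -> : uniq (X k ++ X k.+1).
  rewrite cat_uniq !filter_uniq ?iota_uniq //= andbT.
  apply/hasPn => l; rewrite mem_X => /andP[hl on1]; rewrite mem_X hl /=.
  by apply/negP => on0; apply: X_disj on1.
rewrite andbT; apply/hasPn => l; rewrite mem_cat !mem_X -andb_orr => /andP[/andP[lN _] _].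
by apply/negP => /lowN; rewrite leqNgt lN.
Qed.

End Extension.

Lemma node_split N M l : l <= N + M -> N < l -> exists2 r, 0 < r <= M & l = N + r.
Proof. by move=> h1 h2; exists (l - N); lia. Qed.

(** * Rigorous paths above and along a descending chain *)

Section ChainD.

Variables (N m : nat) (U L : nat -> nat) (k : nat).
Hypothesis low : forall l, 0 < l <= N -> 0 < U l <= m /\ 0 < L l <= m.
Hypothesis chain : forall r, 0 < r <= m -> U (N + r) = r /\ L (N + r) = m.+1.
Hypothesis k_m : 0 < k <= m.

(* The only rigorous path that switches at a node of the chain; likewise [pathA]. *)
Definition pathD (N m k : nat) : seq (nat * nat) :=
  if k == m then [:: (N + m, m.+1)] else [:: (N + k, m.+1); (N + k.+1, k.+1)].

Let on_chain w r : 0 < w <= m -> 0 < r <= m -> on_node U L w (N + r) = (w == r).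
Proof.
by move=> wm rm; rewrite /on_node; have [-> ->] := chain rm; case: (w == r) => //=; lia.
Qed.

Let oth_chain r : 0 < r <= m -> other_wire U L r (N + r) = m.+1.
Proof. by move=> rm; rewrite /other_wire; have [-> ->] := chain rm; rewrite eqxx. Qed.

Let oth_top r : 0 < r <= m -> other_wire U L m.+1 (N + r) = r.
Proof.
by move=> rm; rewrite /other_wire; have [-> ->] := chain rm; case: eqP => //; lia.
Qed.

(* Wire m+1 must be left at its next node: going straight is forbidden there. *)
Let leave_top r p : k <= r -> 0 < r <= m -> walk (N + m) U L k (N + r) m.+1 p ->
  p = [::] \/ r < m /\ p = [:: (N + r.+1, r.+1)].
Proof.
move=> kr rm; case: p => [|[j w'] p]; first by left.
case/and5P=> /andP[j0 jM] _ /eqP ew dir /andP[/allP thr wk]; right.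
have dn w : k < w -> up k w = false by rewrite /up; lia.
move: dir; rewrite /seg_dir dn; last by lia.
move=> lt_j; have [r' r'm ej] := node_split jM (leq_ltn_trans (leq_addr _ _) lt_j).
have er : r' = r.+1.
  apply/eqP; rewrite eqn_leq andbC; apply/andP; split; first by lia.
  rewrite leqNgt; apply/negP => lt_r.
  have r1m : 0 < r.+1 <= m by lia.
  have in1 : N + r.+1 \in inner (N + m) U L (N + r) j m.+1.
    by rewrite mem_inner /on_node (chain r1m).2 eqxx orbT ej; lia.
  have := thr _ in1; rewrite /through oth_top // !dn /=; [lia | lia | lia].
rewrite er in r'm ej; move: ew wk; rewrite ej oth_top // => -> wk.
split; first by lia.
case: p wk => [//|[j2 w2] p] /= /and5P[/andP[j20 j2M] onj _ + _].
rewrite /seg_dir dn; last by lia.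
move=> lt_j2; have lt_N : N < j2 by lia.
have [r2 r2m ej2] := node_split j2M lt_N.
by move: onj; rewrite ej2 on_chain //; lia.
Qed.

(** Entering the chain from above happens on a downward wire [w > k]; the path would then end on
    wire [w+1] or [m+1], both beyond [k+1]. *)
Let stay_low p a w : 0 < a <= N -> 0 < w <= m -> walk (N + m) U L k a w p ->
  last w (map snd p) = k.+1 -> all (fun x => x.1 <= N) p.
Proof.
elim: p a w => [//|[j w'] p IHp] a w aN wm /=.
case/and5P=> /andP[j0 jM] onj /eqP ew dir /andP[_ wk] el.
case: (leqP j N) => [jN|lt_j] /=.
  have j_N : 0 < j <= N by rewrite j0.
  apply: IHp wk el => //; rewrite ew /other_wire.
  by case: ifP; have [] := low j_N.
have [r rm ej] := node_split jM lt_j; move: onj; rewrite ej on_chain // => /eqP er.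
rewrite -er in rm ej; move: dir; rewrite /seg_dir; case: ifP => [_|dn]; first by lia.
have lt_kw : k < w by move: dn; rewrite /up; lia.
move: ew wk el; rewrite ej oth_chain // => ->.
move/(leave_top (ltnW lt_kw) rm) => [->|[_ ->]] /=; lia.
Qed.

Let W w := 0 < w <= m.

Let inner_end r w : 0 < r <= m -> w = r -> inner (N + m) U L (N + r) (N + m).+1 w = [::].
Proof.
move=> rm ->; apply: inner_nil => l /andP[_ lM] onl hl.
have lt_l : N < l by lia.
have [r' r'm el] := node_split lM lt_l; move: onl hl; rewrite el on_chain //; lia.
Qed.

Lemma rig_pathD : rig_path (N + m) U L k (pathD N m k).
Proof.
rewrite /pathD; case: eqP => [e|ne].
  have mm : 0 < m <= m by lia.
  have := chain mm => -[eU eL].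
  rewrite /rig_path e /= [inner _ _ _ (N + m).+1 _ _]inner_sym inner_end // inner_succ.
  rewrite /seg_dir /up leqnn ltnn ltnS leqnn /on_node /other_wire eU eL !eqxx /= !andbT.
  by rewrite leqnn; lia.
have km : 0 < k.+1 <= m by lia.
have [eU eL] := chain k_m; have [eU1 eL1] := chain km.
have i1 : inner (N + m) U L (N + m).+1 (N + k) k = [::] by rewrite inner_sym inner_end.
have i2 : inner (N + m) U L (N + k) (N + k.+1) m.+1 = [::] by rewrite addnS inner_succ.
have i3 : inner (N + m) U L (N + k.+1) (N + m).+1 k.+1 = [::] by rewrite inner_end.
have ne2 : m.+1 == k.+1 = false by lia.
rewrite /rig_path /= i1 i2 i3 /seg_dir /up leqnn ltnn /on_node /other_wire eU eL eU1 eL1 !eqxx ne2 /= ?orbT inE.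
by rewrite eqxx (_ : m < k = false); lia.
Qed.

Let W_node l : 0 < l <= N -> W (U l) && W (L l).
Proof. by move=> /low[hU hL]; rewrite /W hU hL. Qed.

(** At a chain node a wire of the upper part meets wire [m+1], which is downward and has the larger
    label, so going straight is allowed. *)
Let W_through w l : W w -> N < l <= N + m -> on_node U L w l -> through U L k w l.
Proof.
move=> Ww /andP[lN lM]; have [r rm el] := node_split lM lN; rewrite el on_chain //.
move=> /eqP er; have o : other_wire U L w (N + r) = m.+1 by rewrite er oth_chain.
by rewrite /through o /up; move: Ww; rewrite /W; lia.
Qed.

Let ext_D p : k < m -> all (fun x => x.1 <= N) p -> rig_path (N + m) U L k p = rig_path N U L k p.
Proof.
move=> lt_km; apply: (rig_ext (leq_addr m N) W_node W_through k_m) => l /andP[lN lM].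
have [r rm ->] := node_split lM lN; rewrite on_chain // => /eqP er.
by rewrite /on_node (chain rm).1 (chain rm).2; lia.
Qed.

Lemma rig_low_D p : k < m -> rig_path N U L k p -> rig_path (N + m) U L k p.
Proof.
move=> lt_km rp; rewrite ext_D //; have /and3P[/walk_nodes wk _ _] := rp.
by apply: sub_all wk => x /andP[].
Qed.

Let last_low p a w : W w -> walk (N + m) U L k a w p -> all (fun x => x.1 <= N) p ->
  W (last w (map snd p)).
Proof.
elim: p a w => [//|[j w'] p IHp] a w Ww /=.
case/and5P=> /andP[j0 _] _ /eqP-> _ /andP[_ wk] /andP[jN pN].
by apply: IHp wk pN; have := W_node (l := j); rewrite j0 /other_wire; case: ifP => _ /(_ jN)/andP[].
Qed.

Lemma rig_D_inv p : rig_path (N + m) U L k p -> (k < m /\ rig_path N U L k p) \/ p = pathD N m k.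
Proof.
move=> rp; have /and3P[wk /eqP el _] := rp.
case: p rp wk el => [|[j w'] p] rp; first by move=> _ /=; lia.
move=> /= /and5P[/andP[j0 jM] onj /eqP ew dir /andP[_ wk]] el.
case: (leqP j N) => jN.
  have j_N : 0 < j <= N by rewrite j0.
  have w'm : W w' by rewrite ew /other_wire; case: ifP => _; have [] := low j_N.
  have pN := stay_low j_N w'm wk el.
  have lt_km : k < m.
    by have := last_low w'm wk pN; rewrite el /W; lia.
  by left; split=> //; rewrite -ext_D //= jN.
have [r rm ej] := node_split jM jN; move: onj; rewrite ej on_chain // => /eqP er.
rewrite -er in rm ej; move: ew wk el; rewrite ej oth_chain // => -> wk el.
right; rewrite /pathD -er; have [ep|[lt_k ->]] := leave_top (leqnn k) k_m wk.
  by have -> : k = m; [move: el; rewrite ep /=; lia | rewrite eqxx ep].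
by rewrite ltn_eqF.
Qed.

End ChainD.

(** * Rigorous paths above and along an ascending chain *)

Section ChainA.

Variables (N m : nat) (U L : nat -> nat) (k : nat).
Hypothesis low : forall l, 0 < l <= N -> 1 < U l <= m.+1 /\ 1 < L l <= m.+1.
Hypothesis chain : forall r, 0 < r <= m -> U (N + r) = 1 /\ L (N + r) = m.+2 - r.
Hypothesis k_m : 0 < k <= m.

Definition pathA (N m k : nat) : seq (nat * nat) :=
  if k == 1 then [:: (N + m, 2)] else [:: (N + (m.+2 - k), 1); (N + (m.+1 - k), k.+1)].

Let on_chain w r : 1 < w -> 0 < r <= m -> on_node U L w (N + r) = (w == m.+2 - r).
Proof.
by move=> w1 rm; rewrite /on_node; have [-> ->] := chain rm; rewrite gtn_eqF.
Qed.

Let oth_chain r : 0 < r <= m -> other_wire U L (m.+2 - r) (N + r) = 1.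
Proof.
by move=> rm; rewrite /other_wire; have [-> ->] := chain rm; rewrite gtn_eqF //; lia.
Qed.

Let oth_1 r : 0 < r <= m -> other_wire U L 1 (N + r) = m.+2 - r.
Proof. by move=> rm; rewrite /other_wire; have [-> ->] := chain rm. Qed.

Let up_1 : up k 1.
Proof. by rewrite /up; case/andP: k_m. Qed.

(** Wire 1 is oriented upward and avoids the first [N] nodes, so the path must leave it inside the
    chain. Every wire met on the way has a label above [k] and runs downward; the one taken crosses
    the chain only once and leads to the bottom. Going straight is permitted here, so it is the
    endpoint [k+1] that later selects the next node. *)
Let leave_1 r p : 0 < r -> r + k <= m.+2 -> r <= m.+1 ->
  walk (N + m) U L k (N + r) 1 p ->
  exists2 r', 0 < r' < r & p = [:: (N + r', m.+2 - r')].
Proof.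
move=> r0 rk rm; case: p => [|[j w'] p].
  by case/andP; rewrite /seg_dir up_1; lia.
case/and5P=> /andP[j0 jM] onj /eqP ew + /andP[_ wk]; rewrite /seg_dir up_1 => lt_j.
have lt_Nj : N < j.
  rewrite ltnNge; apply/negP => jN; have [] := low (l := j); first by rewrite j0.
  by move: onj; rewrite /on_node => /orP[]/eqP<-.
have [r' r'm ej] := node_split jM lt_Nj.
exists r'; first by lia.
move: ew wk; rewrite ej oth_1 // => ->; case: p => [//|[j2 w2] p].
case/and5P=> /andP[_ j2M] + _ + _; rewrite /seg_dir /up ifN; last by lia.
move=> onj2 lt_j2; have lt_N : N < j2 by lia.
have [r2 r2m ej2] := node_split j2M lt_N.
by move: onj2; rewrite ej2 on_chain; lia.
Qed.

(** From a downward wire [w > k] the chain leads through wire 1 to a wire with a label larger than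
    [w], never to [k+1]. *)
Let stay_low p a w : 0 < a <= N -> 1 < w <= m.+1 -> walk (N + m) U L k a w p ->
  last w (map snd p) = k.+1 -> all (fun x => x.1 <= N) p.
Proof.
elim: p a w => [//|[j w'] p IHp] a w aN wm /=.
case/and5P=> /andP[j0 jM] onj /eqP ew dir /andP[_ wk] el.
case: (leqP j N) => [jN|lt_j] /=.
  have j_N : 0 < j <= N by rewrite j0.
  apply: IHp wk el => //; rewrite ew /other_wire.
  by case: ifP; have [] := low j_N.
have [r rm ej] := node_split jM lt_j; move: onj; rewrite ej on_chain //; last by lia.
move=> /eqP er; move: dir; rewrite /seg_dir; case: ifP => [_|dn]; first by lia.
have lt_kw : k < w by move: dn; rewrite /up; lia.
move=> _; move: ew wk el; rewrite ej er oth_chain // => ->.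
by case/leave_1 => [|||r' r'r ->] /=; lia.
Qed.

Let W w := 1 < w <= m.+1.

Let inner_end r w : 0 < r <= m -> w = m.+2 - r ->
  inner (N + m) U L (N + r) (N + m).+1 w = [::].
Proof.
move=> rm ->; apply: inner_nil => l /andP[_ lM] onl hl.
have lt_l : N < l by lia.
have [r' r'm el] := node_split lM lt_l; move: onl hl; rewrite el on_chain //; lia.
Qed.

Lemma rig_pathA : rig_path (N + m) U L k (pathA N m k).
Proof.
rewrite /pathA; case: eqP => [e|ne].
  have mm : 0 < m <= m by lia.
  have := chain mm => -[eU eL].
  have e2 : m.+2 - m = 2 by lia.
  rewrite /rig_path e /= [inner _ _ _ (N + m).+1 _ _]inner_sym !inner_succ.
  rewrite /seg_dir /up /on_node /other_wire eU eL e2 /=.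
  by lia.
set r := m.+1 - k; have er : m.+2 - k = r.+1 by rewrite /r; lia.
have rm : 0 < r <= m by rewrite /r; lia.
have rm1 : 0 < r.+1 <= m by rewrite /r; lia.
have [eU eL] := chain rm; have [eU1 eL1] := chain rm1.
have ek : m.+2 - r = k.+1 by rewrite /r; lia.
have ek1 : m.+2 - r.+1 = k by rewrite /r; lia.
have i1 : inner (N + m) U L (N + m).+1 (N + r.+1) k = [::].
  by rewrite inner_sym inner_end.
have i2 : inner (N + m) U L (N + r.+1) (N + r) 1 = [::].
  by rewrite inner_sym addnS inner_succ.
have i3 : inner (N + m) U L (N + r) (N + m).+1 k.+1 = [::] by rewrite inner_end.
have nek : k == 1 = false by lia.
rewrite er /rig_path /= i1 i2 i3 /seg_dir /up leqnn ltnn /on_node /other_wire eU eL eU1 eL1 ek ek1.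
by rewrite nek !eqxx /= ?orbT inE (andP k_m).1; lia.
Qed.

Let W_node l : 0 < l <= N -> W (U l) && W (L l).
Proof. by move=> /low[hU hL]; rewrite /W hU hL. Qed.

Let W_through w l : W w -> N < l <= N + m -> on_node U L w l -> through U L k w l.
Proof.
move=> /andP[w1 wm] /andP[lN lM]; have [r rm el] := node_split lM lN.
rewrite el on_chain // => /eqP er; have o : other_wire U L w (N + r) = 1 by rewrite er oth_chain.
by rewrite /through o up_1; lia.
Qed.

Let ext_A p : 1 < k -> all (fun x => x.1 <= N) p -> rig_path (N + m) U L k p = rig_path N U L k p.
Proof.
move=> lt_1k; have Wk : W k by rewrite /W; lia.
apply: (rig_ext (leq_addr m N) W_node W_through Wk) => l /andP[lN lM].
by have [r rm ->] := node_split lM lN; rewrite !on_chain //; lia.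
Qed.

Lemma rig_low_A p : 1 < k -> rig_path N U L k p -> rig_path (N + m) U L k p.
Proof.
move=> lt_1k rp; rewrite ext_A //; have /and3P[/walk_nodes wk _ _] := rp.
by apply: sub_all wk => x /andP[].
Qed.

Lemma rig_A_inv p : rig_path (N + m) U L k p -> (1 < k /\ rig_path N U L k p) \/ p = pathA N m k.
Proof.
move=> rp; have /and3P[wk /eqP el _] := rp; rewrite /pathA.
case: eqP => [k1|nk1].
  (* For [k = 1] the path starts on the chain wire itself, and its bottom end serves as a chain node
     with [r = m+1]. *)
  have wk1 : walk (N + m) U L k (N + m.+1) 1 p by move: wk; rewrite -addnS {2}k1.
  have [|||r' r'm ep] := leave_1 _ _ _ wk1; [lia | lia | lia |].
  have e2 : m.+2 - r' = 2 by move: el; rewrite ep k1.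
  by right; rewrite ep e2 (_ : r' = m) //; lia.
have lt_1k : 1 < k by lia.
case: p rp wk el => [|[j w'] p] rp; first by move=> _ /=; lia.
move=> /= /and5P[/andP[j0 jM] onj /eqP ew dir /andP[_ wk]] el.
case: (leqP j N) => jN.
  have j_N : 0 < j <= N by rewrite j0.
  have w'm : W w' by rewrite ew /other_wire; case: ifP => _; have [] := low j_N.
  have pN := stay_low j_N w'm wk el.
  by left; split=> //; rewrite -ext_A //= jN.
have [r rm ej] := node_split jM jN; move: onj; rewrite ej on_chain // => /eqP er.
move: ew wk el; rewrite ej {1}er oth_chain // => -> wk el; right.
have [|||r' r'm ep] := leave_1 _ _ _ wk; try lia.
move: el; rewrite ep /= => el; congr [:: (_, _); (_, _)]; lia.
Qed.

End ChainA.

(** * String inequalities *)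

Local Open Scope ring_scope.
Local Notation coord := Defs.coord.

(** Coordinates are a function on all naturals, so that one point serves both a word and the word
    without its chain. *)
Fixpoint pval (R : realFieldType) (t : nat -> R) (w : nat) (p : seq (nat * nat)) : R :=
  if p is (j, w') :: p' then (if (w < w')%N then t j else - t j) + pval t w' p' else 0.

Lemma strCoef_cons k j w p l :
  strCoef k ((j, w) :: p) l =
  (if j == l then (if (k < w)%N then 1 else -1) else 0) + strCoef w p l.
Proof. by rewrite /strCoef /= big_cons. Qed.

Lemma pval_strCoef (R : realFieldType) (t : nat -> R) N k p :
  all (fun x => 0 < x.1 <= N)%N p ->
  \sum_(j < N) (strCoef k p j.+1)%:~R * t j.+1 = pval t k p.
Proof.
elim: p k => [|[j w] p IHp] k /=.
  by move=> _; rewrite big1 // => l _; rewrite /strCoef /= big_nil mul0r.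
case/andP=> jN pN; rewrite -(IHp w pN).
under eq_bigr => l _ do rewrite strCoef_cons rmorphD mulrDl.
rewrite big_split /=; congr (_ + _).
have lt_j : (j.-1 < N)%N by lia.
rewrite (bigD1 (Ordinal lt_j)) //= prednK ?(andP jN).1 // eqxx big1 ?addr0.
  by case: ifP => _; rewrite ?mul1r // rmorphN1 mulN1r.
move=> l /eqP ne; case: eqP => [ej|_]; last by rewrite mul0r.
by case: ne; apply: val_inj; rewrite /= ej.
Qed.

Lemma pval_relabel (R : realFieldType) (t t' : nat -> R) (f g : nat -> nat) (W : pred nat) w p :
  (forall x y, W x -> W y -> (g x < g y)%N = (x < y)%N) ->
  (forall j, t' (f j) = t j) -> W w -> all (fun x => W x.2) p ->
  pval t' (g w) (map (fun x => (f x.1, g x.2)) p) = pval t w p.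
Proof.
move=> gm tf; elim: p w => [//|[j w'] p IHp] w Ww /= /andP[Ww' Wp].
by rewrite gm // tf IHp.
Qed.

Definition cone (R : realFieldType) (N : nat) (U L : nat -> nat) (n : nat) (t : nat -> R) : Prop :=
  forall k p, (0 < k <= n)%N -> rig_path N U L k p -> 0 <= pval t k p.

(** Minus the Cartan matrix of type A. *)
Definition letter_coef (a b : nat) : int :=
  if b == a then -2 else if ((b == a.+1) || (a == b.+1))%N then 1 else 0.

Definition lamIneq (R : realFieldType) (N : nat) (i : seq nat) (lam t : nat -> R) : Prop :=
  forall j, (0 < j <= N)%N ->
  t j <= lam (ix i j) + \sum_(j.+1 <= l < N.+1) (letter_coef (ix i j) (ix i l))%:~R * t l.

Definition stringIneq (R : realFieldType) (n : nat) (i : seq nat) (lam t : nat -> R) : Prop :=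
  cone (NN n) (wireU n i) (wireL n i) n t /\ lamIneq (NN n) i lam t.

Lemma coord_ord (R : realFieldType) N (y : 'rV[R]_N) (q : 'I_N) : coord y q = y 0 q.
Proof. by rewrite /coord (big_pred1 q). Qed.

(** The default value matters: with the coordinate behind the last chain node equal to 0, the end of
    the chain obeys the same formulas as its interior. *)
Lemma coord_out (R : realFieldType) N (y : 'rV[R]_N) q : (N <= q)%N -> coord y q = 0.
Proof.
by move=> leNq; rewrite /coord big_pred0 // => l; rewrite ltn_eqF // (leq_trans _ leNq) /=.
Qed.

Lemma stringPolyE (R : realFieldType) n i (lam : nat -> nat) (x : 'rV[R]_(NN n)) :
  stringPoly i lam x <->
  stringIneq n i (fun a => (lam a)%:R) (fun j => coord x j.-1).
Proof.
have Ep k p : rigorous n i k p ->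
    \sum_(j < NN n) (strCoef k p j.+1)%:~R * x 0 j = pval (fun j => coord x j.-1) k p.
  rewrite rigorousE => /and3P[/walk_nodes pN _ _]; rewrite -(pval_strCoef _ _ pN).
  by apply: eq_bigr => j _; rewrite coord_ord.
have El (j : 'I_(NN n)) :
    \sum_(l < NN n | (val j < val l)%N) (lamCoef i j.+1 l.+1)%:~R * x 0 l =
    \sum_(j.+2 <= l < (NN n).+1) (letter_coef (ix i j.+1) (ix i l))%:~R * coord x l.-1.
  rewrite big_add1 (big_nat_widenl _ 0%N) //= big_mkord.
  by apply: eq_bigr => l _; rewrite coord_ord.
split=> -[hc hl]; split.
- by move=> k p hk; rewrite -rigorousE => rp; rewrite -Ep //; apply: hc.
- move=> j /andP[j0 jN]; have lt_j : (j.-1 < NN n)%N by lia.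
  have := hl (Ordinal lt_j); rewrite El /= prednK //.
  by rewrite -(coord_ord x (Ordinal lt_j)).
- by move=> k p hk rp; rewrite Ep //; apply: hc; rewrite // -rigorousE.
- by move=> j; rewrite El -coord_ord; apply: (hl j.+1); rewrite ltn_ord.
Qed.

Lemma rig_eq N U L U' L' k p :
  (forall l, (0 < l <= N)%N -> U' l = U l /\ L' l = L l) ->
  rig_path N U L k p -> rig_path N U' L' k p.
Proof.
move=> e rp; rewrite -[p]map_id.
rewrite (@eq_map _ _ id (fun x => (id x.1, id x.2))); last by case.
by apply: (@rig_relabel N U L U' L' id id k k predT) rp.
Qed.

Lemma lamIneq_eq (R : realFieldType) N i i' (lam lam' t t' : nat -> R) :
  (forall j, (0 < j <= N)%N -> [/\ ix i j = ix i' j, t j = t' j & lam (ix i j) = lam' (ix i j)]) ->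
  lamIneq N i lam t -> lamIneq N i' lam' t'.
Proof.
move=> e h j hj; have [eij et el] := e _ hj.
have := h _ hj; rewrite et el eij; congr (_ <= _ + _).
rewrite big_seq_cond [RHS]big_seq_cond; apply: eq_bigr => l.
rewrite mem_index_iota andbT => hl; have [|-> -> _] // := e l; lia.
Qed.

Lemma pval_eq (R : realFieldType) (t t' : nat -> R) N k p :
  (forall j, (0 < j <= N)%N -> t j = t' j) -> all (fun x => 0 < x.1 <= N)%N p ->
  pval t k p = pval t' k p.
Proof.
by move=> e; elim: p k => [//|[j w] p IHp] k /= /andP[hj hp]; rewrite e // IHp.
Qed.

Lemma stringIneq_eq (R : realFieldType) n i (lam lam' t t' : nat -> R) : Sigma n i ->
  (forall j, (0 < j <= NN n)%N -> t j = t' j) ->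
  (forall a, (0 < a <= n)%N -> lam a = lam' a) ->
  stringIneq n i lam t -> stringIneq n i lam' t'.
Proof.
move=> Si et el [hc hl]; split.
  move=> k p hk rp; have /and3P[/walk_nodes pN _ _] := rp.
  by rewrite -(pval_eq k et pN); apply: hc.
by apply: lamIneq_eq hl => j hj; split; rewrite ?et ?el //; apply: ix_letter Si _.
Qed.

(** * Invariance of the inequalities under 2-moves *)

Lemma letter_coef_far a b : far a b -> letter_coef a b = 0.
Proof. by rewrite /far /letter_coef => h; rewrite !ifN //; lia. Qed.

Lemma node_swap_lt m l l' : l != l' -> (node_swap m l < node_swap m l')%N != (l < l')%N ->
  (l = m /\ l' = m.+1) \/ (l = m.+1 /\ l' = m).
Proof. by rewrite /node_swap; repeat case: eqP => //; lia. Qed.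

Lemma node_swap_node m N l : (0 < m < N)%N -> (0 < l <= N)%N -> (0 < node_swap m l <= N)%N.
Proof. by rewrite /node_swap; repeat case: eqP => //; lia. Qed.

Lemma two_move_ixm u a b v :
  ix (u ++ a :: b :: v) (size u).+1 = a /\ ix (u ++ a :: b :: v) (size u).+2 = b.
Proof.
by rewrite /ix /= !nth_cat ltnn ltnNge leqnSn subnn subSnn.
Qed.

(** Far letters occupy four distinct positions, which carry distinct wires. *)
Lemma two_move_disjoint n u a b v w (i := u ++ a :: b :: v) (m := (size u).+1) :
  far a b -> Sigma n i ->
  on_node (wireU n i) (wireL n i) w m -> on_node (wireU n i) (wireL n i) w m.+1 -> False.
Proof.
move=> far_ab Si; have [ea eb] := two_move_ixm u a b v.
have := Sigma_letters Si; rewrite all_cat /= => /and4P[_ a_n b_n _].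
rewrite /on_node /wireU /wireL ea eb /arr /i /m /= !take_cat ltnn ltnNge leqnSn subnn subSnn /=.
rewrite cats0 foldl_cat /=; have := perm_state Si; set s := foldl _ _ u => ps.
have sz : size s = n.+1 by rewrite (perm_size ps) size_iota.
have us : uniq s by rewrite (perm_uniq ps) iota_uniq.
have [|||-> ->] // := @nth_swapAt_far s a b; rewrite ?sz //; [lia|].
have ne q1 q2 : (q1 < n.+1)%N -> (q2 < n.+1)%N -> q1 != q2 -> nth 0%N s q1 != nth 0%N s q2.
  by move=> h1 h2; rewrite nth_uniq ?sz.
move: far_ab; rewrite /far => far_ab.
by move=> /orP[]/eqP-> /orP[]/eqP e; have /eqP[] := e; apply/negP/ne; lia.
Qed.

(** Only the two moved nodes change their order. They share no wire, so rigorous paths correspond;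
    their letters are far, so neither coordinate enters the lambda-inequality of the other. *)
Lemma two_move_stringIneq (R : realFieldType) n u a b v (lam t : nat -> R) :
  far a b -> Sigma n (u ++ a :: b :: v) ->
  stringIneq n (u ++ a :: b :: v) lam t ->
  stringIneq n (u ++ b :: a :: v) lam (t \o node_swap (size u).+1).
Proof.
move=> far_ab Si [hc hl]; set m := (size u).+1; set i := u ++ a :: b :: v.
set i' := u ++ b :: a :: v; have far_ba : far b a by rewrite farC.
have Si' : Sigma n i'.
  by apply: two_move_Sigma Si; exists u, v, a, b.
have mN : (0 < m < NN n)%N by rewrite -(Sigma_size Si) /m size_cat /=; lia.
have wf l : (0 < l <= NN n)%N -> wireU n i (node_swap m l) = wireU n i' l /\
    wireL n i (node_swap m l) = wireL n i' l by exact: two_move_wires far_ba Si'.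
split.
  move=> k p hk rp.
  have Em : (NN n).+1 != m /\ (NN n).+1 != m.+1 by lia.
  have trN : node_swap m (NN n).+1 = (NN n).+1.
    by rewrite /node_swap (negbTE Em.1) (negbTE Em.2).
  have rp' := @rig_relabel _ _ _ _ _ _ id k k predT (node_swapK m) trN
    (fun l => node_swap_node mN) wf (fun _ _ => isT) (fun _ _ _ _ => erefl) isT erefl isT erefl _ p rp.
  rewrite -(@pval_relabel R (t \o node_swap m) t (node_swap m) id predT) ?all_predT //.
  apply: hc hk (rp' _) => w l l'.
  have [->|ne] := eqVneq l l'; first by rewrite !ltnn.
  move=> nl nl'; case: (boolP ((node_swap m l < node_swap m l')%N == (l < l')%N)) => [/eqP //|].
  move/(node_swap_lt ne) => H; exfalso.
  have [wm wm1] : on_node (wireU n i') (wireL n i') w m /\ on_node (wireU n i') (wireL n i') w m.+1.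
    move: nl nl'; case: H => -[-> ->]; rewrite !(eq_sym _ (NN n).+1) (negbTE Em.1) (negbTE Em.2) /=.
      by move=> /andP[_ ->] /andP[_ ->].
    by move=> /andP[_ ->] /andP[_ ->].
  exact: two_move_disjoint far_ba Si' wm wm1.
move=> j hj.
have hj' := node_swap_node mN hj.
have Eix l : (0 < l)%N -> ix i' l = ix i (node_swap m l).
  by move=> l0; rewrite -(two_move_ix u b a v l0).
have := hl _ hj'; rewrite -Eix ?(andP hj).1 //; congr (_ <= _ + _).
(* The range [l > d] becomes a condition inside a sum over all nodes, which the renumbering
   permutes. *)
have S (F : nat -> R) (d : nat) : \sum_(d.+1 <= l < (NN n).+1) F l =
    \sum_(l <- index_iota 1 (NN n).+1) (if (d < l)%N then F l else 0).
  by rewrite (big_nat_widenl _ 1%N) // big_mkcond.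
rewrite (S _ (node_swap m j)) (S _ j) (perm_big (map (node_swap m) (index_iota 1 (NN n).+1))); last first.
  apply: uniq_perm; rewrite ?(map_inj_uniq (inv_inj (node_swapK m))) ?iota_uniq // => l.
  rewrite -[in RHS](node_swapK m l) (mem_map (inv_inj (node_swapK m))) !mem_index_iota !ltnS.
  apply/idP/idP => [|h]; first exact: node_swap_node.
  by rewrite -[l](node_swapK m); apply: node_swap_node.
rewrite big_map big_seq [RHS]big_seq; apply: eq_bigr => l; rewrite mem_index_iota => /andP[l0 lN].
rewrite -Eix //=.
have [->|ne] := eqVneq j l; first by rewrite !ltnn.
case: (boolP ((node_swap m j < node_swap m l)%N == (j < l)%N)) => [/eqP -> //|].
move/(node_swap_lt ne) => H; suff -> : letter_coef (ix i' j) (ix i' l) = 0 by rewrite !mul0r !if_same.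
have [e1 e2] := two_move_ixm u b a v.
by apply: letter_coef_far; case: H => -[-> ->]; rewrite /i' /m e1 e2.
Qed.

(** * Splitting the inequalities along a final chain *)

Lemma letter_coef_sum (R : realFieldType) (a r0 r1 p0 p1 p2 : nat) (b : nat -> nat) (f : nat -> R) :
  (forall r, (r0 <= r < r1)%N -> [/\ (b r == a) = (r == p0), (b r == a.+1) = (r == p1)
     & (a == (b r).+1) = (r == p2)]) ->
  \sum_(r0 <= r < r1) (letter_coef a (b r))%:~R * f r =
  - 2 * (if (r0 <= p0 < r1)%N then f p0 else 0) + (if (r0 <= p1 < r1)%N then f p1 else 0)
  + (if (r0 <= p2 < r1)%N then f p2 else 0).
Proof.
move=> e.
(* A chain contains a letter at most once; [p0], [p1], [p2] are the places of [a], [a+1], [a-1], and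
   a place out of range contributes 0. *)
have D p : \sum_(r0 <= r < r1) (if r == p then f r else 0) = if (r0 <= p < r1)%N then f p else 0.
  by rewrite -big_mkcond big_nat1_eq.
rewrite -!D mulr_sumr -!big_split /= big_seq [RHS]big_seq; apply: eq_bigr => r.
rewrite mem_index_iota => /e[<- <- <-]; rewrite /letter_coef.
case: (b r =P a) => [->|_].
  rewrite (ltn_eqF (ltnSn a)) /=; ring.
case: (b r =P a.+1) => [->|_] /=.
  rewrite (ltn_eqF (leqW (ltnSn a))) /=; ring.
by case: eqP => _; ring.
Qed.

(** Behind a chain node only the next chain letter contributes. A node of [u] has the whole chain
    below it, so the contribution of the chain depends on its letter alone and can be absorbed into
    a new weight [lam']. *)
Lemma lamIneq_step (R : realFieldType) N m i u (s b : nat -> nat) (lam lam' t : nat -> R) :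
  (forall j, (0 < j <= N)%N -> ix i j = s (ix u j) /\ (0 < ix u j < m)%N) ->
  (forall r, (0 < r <= m)%N -> ix i (N + r) = b r) ->
  (forall a a', letter_coef (s a) (s a') = letter_coef a a') ->
  (forall r, (0 < r <= m)%N ->
     \sum_(r.+1 <= r' < m.+1) (letter_coef (b r) (b r'))%:~R * t (N + r')%N = t (N + r.+1)%N) ->
  (forall a, (0 < a < m)%N ->
     lam (s a) + \sum_(1 <= r < m.+1) (letter_coef (s a) (b r))%:~R * t (N + r)%N = lam' a) ->
  lamIneq (N + m) i lam t <->
  (forall r, (0 < r <= m)%N -> t (N + r)%N <= lam (b r) + t (N + r.+1)%N) /\
  lamIneq N u lam' t.
Proof.
move=> ixl ixc lcs hc hl.
have shift F q : \sum_(N + q <= l < (N + m).+1) F l = \sum_(q <= r < m.+1) F (N + r)%N :> R.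
  rewrite addnC big_addn -addnS addnC addnK.
  by apply: eq_bigr => r _; rewrite addnC.
have chainE r : (0 < r <= m)%N ->
    \sum_((N + r).+1 <= l < (N + m).+1) (letter_coef (ix i (N + r)) (ix i l))%:~R * t l = t (N + r.+1)%N.
  move=> hr; rewrite -addnS shift -hc //; rewrite big_seq [RHS]big_seq.
  by apply: eq_bigr => r'; rewrite mem_index_iota => hr'; rewrite !ixc //; lia.
have lowE j : (0 < j <= N)%N ->
    lam (ix i j) + \sum_(j.+1 <= l < (N + m).+1) (letter_coef (ix i j) (ix i l))%:~R * t l =
    lam' (ix u j) + \sum_(j.+1 <= l < N.+1) (letter_coef (ix u j) (ix u l))%:~R * t l.
  move=> hj; have [ej hu] := ixl _ hj; rewrite (@big_cat_nat _ _ _ N.+1) /=; [|lia|lia].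
  rewrite -[N.+1 in X in _ + (_ + X)]addn1 shift addrCA addrC ej; congr (_ + _); last first.
    rewrite big_seq [RHS]big_seq; apply: eq_bigr => l; rewrite mem_index_iota => hl'.
    by rewrite (ixl l _).1 ?lcs //; lia.
  rewrite -hl //; congr (_ + _); rewrite big_seq [RHS]big_seq; apply: eq_bigr => r.
  by rewrite mem_index_iota => hr; rewrite ixc //; lia.
split=> [h|[h1 h2] j hj].
  split=> [r hr|j hj]; last by rewrite -lowE //; apply: h; lia.
  have hr' : (0 < N + r <= N + m)%N by lia.
  by have := h _ hr'; rewrite chainE // ixc.
have [jN|Nj] := leqP j N; first by rewrite lowE ?h2 //; lia.
have [r hr ->] := @node_split N m j (andP hj).2 Nj.
by rewrite chainE // ixc // h1.
Qed.

Lemma cone_D (R : realFieldType) n u (i := u ++ rev (iota 1 n.+1)) (t : nat -> R) :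
  Sigma n.+1 i -> t (NN n + n.+2)%N = 0 ->
  cone (NN n + n.+1) (wireU n.+1 i) (wireL n.+1 i) n.+1 t <->
  (forall r, (0 < r <= n.+1)%N -> t (NN n + r.+1)%N <= t (NN n + r)%N) /\
  cone (NN n) (wireU n u) (wireL n u) n t.
Proof.
move=> Si t0; have [hlow hchain] := Sigma_D_wires Si; have Su := Sigma_D Si.
have low l : (0 < l <= NN n)%N ->
    (0 < wireU n.+1 i l <= n.+1)%N /\ (0 < wireL n.+1 i l <= n.+1)%N.
  by move=> hl; have [_ -> ->] := hlow _ hl; have := Sigma_wires Su hl; lia.
have chain r : (0 < r <= n.+1)%N ->
    wireU n.+1 i (NN n + r) = r /\ wireL n.+1 i (NN n + r) = n.+2.
  by move=> hr; have [] := hchain _ hr.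
(* Switching to wire [n+2] counts positively and leaving it negatively; for [k = n+1] it is not
   left, and [t0] supplies the second term. *)
have pE k : (0 < k <= n.+1)%N ->
    pval t k (pathD (NN n) n.+1 k) = t (NN n + k)%N - t (NN n + k.+1)%N.
  move=> hk; rewrite /pathD; case: eqP => [->|ne] /=.
    by rewrite ltnSn t0 subr0 addr0.
  have -> : (k < n.+2)%N by lia.
  have -> : (n.+2 < k.+1)%N = false by lia.
  by rewrite addr0.
split=> [h|[h1 h2] k p hk].
  split=> [r hr|k p hk rp].
    by rewrite -subr_ge0 -pE //; apply: h => //; apply: rig_pathD.
  apply: h; first by lia.
  apply: (rig_low_D low chain); try lia.
  by apply: rig_eq rp => l hl; have [_ -> ->] := hlow _ hl.
case/(rig_D_inv low chain hk) => [[lt_k rp]|->]; last by rewrite pE // subr_ge0 h1.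
apply: h2; first by lia.
by apply: rig_eq rp => l hl; have [_ -> ->] := hlow _ hl.
Qed.

(** The wires of [u] are shifted by one, so paths of index [k] in [u] become paths of index [k+1].
    The chain path of index [k] compares the chain nodes [n+2-k] and [n+3-k]. *)
Lemma cone_A (R : realFieldType) n u (i := map succn u ++ iota 1 n.+1) (t : nat -> R) :
  Sigma n.+1 i -> Sigma n u -> t (NN n + n.+2)%N = 0 ->
  cone (NN n + n.+1) (wireU n.+1 i) (wireL n.+1 i) n.+1 t <->
  (forall r, (0 < r <= n.+1)%N -> t (NN n + r.+1)%N <= t (NN n + r)%N) /\
  cone (NN n) (wireU n u) (wireL n u) n t.
Proof.
move=> Si Su t0; have [hlow hchain] := Sigma_A_wires Si Su.
have low l : (0 < l <= NN n)%N ->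
    (1 < wireU n.+1 i l <= n.+2)%N /\ (1 < wireL n.+1 i l <= n.+2)%N.
  by move=> hl; have [_ -> ->] := hlow _ hl; have := Sigma_wires Su hl; lia.
have chain r : (0 < r <= n.+1)%N ->
    wireU n.+1 i (NN n + r) = 1%N /\ wireL n.+1 i (NN n + r) = (n.+3 - r)%N.
  by move=> hr; have [] := hchain _ hr.
have pE k : (0 < k <= n.+1)%N ->
    pval t k (pathA (NN n) n.+1 k) = t (NN n + (n.+2 - k))%N - t (NN n + (n.+2 - k).+1)%N.
  move=> hk; rewrite /pathA; case: eqP => [->|ne] /=.
    by rewrite subSS subn0 t0 subr0 addr0.
  rewrite ifN ?ifT ?addr0; [|lia|lia].
  by rewrite addrC; congr (t (NN n + _)%N - t (NN n + _)%N); lia.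
split=> [h|[h1 h2] k p hk].
  split=> [r hr|k p hk rp].
    have hr' : (0 < n.+2 - r <= n.+1)%N by lia.
    have er : (n.+2 - (n.+2 - r) = r)%N by lia.
    by rewrite -subr_ge0 -{1}er -{2}er -pE //; apply: h => //; apply: rig_pathA.
  have Wp : all (fun x => predT x.2) p by apply/allP.
  rewrite -(@pval_relabel R t t id succn predT k p (fun _ _ _ _ => erefl) (fun _ => erefl) isT) //.
  apply: h; first by lia.
  apply: (rig_low_A low chain); try lia.
  apply: (@rig_relabel (NN n) (wireU n u) (wireL n u) _ _ id succn k k.+1 predT) rp => //.
  by move=> l hl; have [_ -> ->] := hlow _ hl.
case/(rig_A_inv low chain hk) => [[lt_k rp]|->]; last by rewrite pE // subr_ge0 h1 //; lia.
have W0 l : (0 < l <= NN n)%N -> (0 < wireU n.+1 i l)%N && (0 < wireL n.+1 i l)%N.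
  by move=> /low; lia.
(* The shift is undone by [predn], which is strictly monotone only on positive labels. *)
have mono x y : (0 < x)%N -> (0 < y)%N -> (x.-1 < y.-1)%N = (x < y)%N by lia.
have /and3P[wk _ _] := rp; have Wp := walk_wires W0 wk.
rewrite -(@pval_relabel R t t id predn (fun w => 0 < w)%N k p mono) //; last by lia.
apply: h2; first by lia.
apply: (@rig_relabel (NN n) _ _ (wireU n u) (wireL n u) id predn k k.-1 (fun w => 0 < w)%N) rp => //; try lia.
by move=> l hl; have [_ -> ->] := hlow _ hl.
Qed.

(** With [j = n+1-r] the row is [z_j = mu_j + c_(r+1) - c_r]: the string inequality at [r] is the
    bound [z_j <= mu_j], and the lambda-inequality of the letter [n+2-r] is the bound
    [mu_(j+1) <= z_j]. At a letter [a] of [u] the chain contributes a second difference of [c],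
    which turns the weight into [z_(a-1) - z_a]. *)
Lemma stringIneq_D (R : realFieldType) n u (i := u ++ rev (iota 1 n.+1)) (mu t : nat -> R)
  (z := fun j => mu j + t (NN n + (n.+1 - j).+1)%N - t (NN n + (n - j).+1)%N) :
  Sigma n.+1 i -> t (NN n + n.+2)%N = 0 ->
  stringIneq n.+1 i (fun a => mu a.-1 - mu a) t <->
  (forall j, (j <= n)%N -> z j <= mu j /\ mu j.+1 <= z j) /\
  stringIneq n u (fun a => z a.-1 - z a) t.
Proof.
move=> Si t0; have [hlow hchain] := Sigma_D_wires Si; have Su := Sigma_D Si.
rewrite /stringIneq NN_S (cone_D Si t0).
rewrite (@lamIneq_step R (NN n) n.+1 i u id (fun r => n.+2 - r)%N _ (fun a => z a.-1 - z a)) //.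
- have zE r : (0 < r <= n.+1)%N ->
      z (n.+1 - r)%N = mu (n.+1 - r)%N + t (NN n + r.+1)%N - t (NN n + r)%N.
    by move=> hr; rewrite /z; congr (_ + t (_ + _)%N - t (_ + _)%N); lia.
  split=> [[[h1 h2] [h3 h4]]|[h1 [h2 h3]]].
    split=> // j hj; have hr : (0 < n.+1 - j <= n.+1)%N by lia.
    have ej : (n.+1 - (n.+1 - j) = j)%N by lia.
    have := h1 _ hr; have := h3 _ hr; have := zE _ hr; rewrite ej => ->.
    have -> : (n.+2 - (n.+1 - j) = j.+1)%N by lia.
    by rewrite /=; lra.
  split; [split=> // r hr | split=> // r hr].
    have /h1[] : (n.+1 - r <= n)%N by lia.
    by rewrite zE //; lra.
  have /h1[_] : (n.+1 - r <= n)%N by lia.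
  have -> : (n.+2 - r).-1 = (n.+1 - r)%N by lia.
  have -> : (n.+1 - r).+1 = (n.+2 - r)%N by lia.
  by rewrite zE //; lra.
- by move=> j hj; have [-> _ _] := hlow _ hj; have := ix_letter Su hj.
- by move=> r hr; have [->] := hchain _ hr.
- move=> r hr; rewrite (@letter_coef_sum _ _ _ _ r r.-1 r.+1 (fun r => n.+2 - r)%N (fun r => t (NN n + r)%N)).
    rewrite ltnn [(r < r.-1)%N]ltnNge leq_pred ltnSn /= mulr0 !add0r.
    case: ltnP => // ge; suff -> : r.+1 = n.+2 by rewrite t0.
    by lia.
  by move=> r' hr'; split; lia.
- move=> a ha; rewrite (@letter_coef_sum _ _ _ _ (n.+2 - a) (n.+1 - a) (n.+3 - a) (fun r => n.+2 - r)%N (fun r => t (NN n + r)%N)).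
    rewrite [if (0 < n.+2 - a < n.+2)%N then _ else _]ifT; last by lia.
    rewrite [if (0 < n.+1 - a < n.+2)%N then _ else _]ifT; last by lia.
    have -> : (if (0 < n.+3 - a < n.+2)%N then t (NN n + (n.+3 - a))%N else 0) = t (NN n + (n.+3 - a))%N.
      case: ifP => // ge; suff -> : (n.+3 - a = n.+2)%N by rewrite t0.
      by lia.
    rewrite /z.
    have -> : (n.+1 - a.-1).+1 = (n.+3 - a)%N by lia.
    have -> : (n - a.-1).+1 = (n.+2 - a)%N by lia.
    have -> : (n.+1 - a).+1 = (n.+2 - a)%N by lia.
    have -> : (n - a).+1 = (n.+1 - a)%N by lia.
    ring.
  by move=> r' hr'; split; lia.
Qed.

(** The chain letters now increase, and the bounds exchange their origin: the string inequality
    gives [mu_(j+1) <= z_j], the lambda-inequality gives [z_j <= mu_j]. *)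
Lemma stringIneq_A (R : realFieldType) n u (i := map succn u ++ iota 1 n.+1) (mu t : nat -> R)
  (z := fun j => mu j.+1 + t (NN n + j.+1)%N - t (NN n + j.+2)%N) :
  Sigma n.+1 i -> Sigma n u -> t (NN n + n.+2)%N = 0 ->
  stringIneq n.+1 i (fun a => mu a.-1 - mu a) t <->
  (forall j, (j <= n)%N -> z j <= mu j /\ mu j.+1 <= z j) /\
  stringIneq n u (fun a => z a.-1 - z a) t.
Proof.
move=> Si Su t0; have [hlow hchain] := Sigma_A_wires Si Su.
rewrite /stringIneq NN_S (cone_A Si Su t0).
rewrite (@lamIneq_step R (NN n) n.+1 i u succn id _ (fun a => z a.-1 - z a)) //.
- split=> [[[h1 h2] [h3 h4]]|[h1 [h2 h3]]].
    split=> // j hj; have hr : (0 < j.+1 <= n.+1)%N by lia.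
    have := h1 _ hr; have := h3 _ hr; rewrite /z /=; lra.
  split; [split=> // r hr | split=> // r hr]; case: r hr => // r hr.
    by have := h1 r hr; rewrite /z; lra.
  by have := h1 r hr; rewrite /z /=; lra.
- by move=> j hj; have [-> _ _] := hlow _ hj; have := ix_letter Su hj.
- by move=> r hr; have [->] := hchain _ hr.
- move=> r hr; rewrite (@letter_coef_sum _ _ _ _ r r.+1 r.-1 id (fun r => t (NN n + r)%N)).
    rewrite ltnn [(r < r.-1)%N]ltnNge leq_pred ltnSn /= mulr0 addr0 add0r.
    case: ltnP => // ge; suff -> : r.+1 = n.+2 by rewrite t0.
    by lia.
  by move=> r' hr'; split; lia.
- move=> a ha; rewrite (@letter_coef_sum _ _ _ _ a.+1 a.+2 a id (fun r => t (NN n + r)%N)).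
    rewrite [if (0 < a.+1 < n.+2)%N then _ else _]ifT; last by lia.
    rewrite [if (0 < a < n.+2)%N then _ else _]ifT; last by lia.
    have -> : (if (0 < a.+2 < n.+2)%N then t (NN n + a.+2)%N else 0) = t (NN n + a.+2)%N.
      case: ifP => // ge; suff -> : a.+2 = n.+2 by rewrite t0.
      by lia.
    rewrite /z prednK ?(andP ha).1 //=; ring.
  by move=> r' hr'; split; lia.
Qed.

(** * Gelfand-Cetlin patterns and the integral change of variables *)

Definition GCpattern (R : realFieldType) (n : nat) (top y : nat -> R) : Prop :=
  forall k j, (0 < j)%N -> (j <= k)%N -> (k <= n)%N ->
  let x k j := if k == n.+1 then top j.-1 else y (gcIdx k j) in
  x k j <= x k.+1 j /\ x k.+1 j.+1 <= x k j.

Lemma GCpolyE (R : realFieldType) n (lam : nat -> nat) (y : 'rV[R]_(NN n)) :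
  GCpoly lam y <->
  GCpattern n (fun j => \sum_(j.+1 <= l < n.+1) (lam l)%:R) (coord y).
Proof.
have E k j : (0 < j)%N -> gcx lam y k j =
    if k == n.+1 then \sum_(j.-1.+1 <= l < n.+1) (lam l)%:R else coord y (gcIdx k j).
  by move=> j0; rewrite /gcx prednK // natr_sum.
by split=> h k j j0 jk kn; have := h k j j0 jk kn; rewrite /= !E.
Qed.

Lemma gcIdx_lt k j n : (0 < j)%N -> (j <= k)%N -> (k <= n)%N -> (gcIdx k j < NN n)%N.
Proof.
move=> j0 jk kn; rewrite /gcIdx; apply: (@leq_trans (NN k)).
  by case: k jk kn => [|k] jk kn; rewrite ?NN_bin ?NN_S; lia.
elim: n kn => [|n IHn]; first by rewrite leqn0 => /eqP->.
by rewrite leq_eqVlt => /orP[/eqP-> //|/IHn]; rewrite NN_S; lia.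
Qed.

(** Row [n+1] is stored just behind the smaller triangle, whose top row it becomes; the chain
    coordinates of a word occupy the same block. *)
Lemma GCpattern_rec (R : realFieldType) n (top y : nat -> R) :
  GCpattern n.+1 top y <->
  (forall j, (j <= n)%N -> y (NN n + j)%N <= top j /\ top j.+1 <= y (NN n + j)%N) /\
  GCpattern n (fun j => y (NN n + j)%N) y.
Proof.
have E j : gcIdx n.+1 j = (NN n + j.-1)%N by rewrite /gcIdx NN_bin.
split=> [h|[h1 h2] k j j0 jk kn].
  split=> [j hj|k j j0 jk kn x].
    have := h n.+1 j.+1; rewrite /= eqxx (ltn_eqF (ltnSn _)) !E /=; apply; lia.
  have := h k j j0 jk (leqW kn); rewrite /= /x eqSS (ltn_eqF (_ : k < n.+2)%N); last by lia.
  rewrite (ltn_eqF (_ : k < n.+1)%N); last by lia.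
  by case: eqP => [->|//]; rewrite !E.
rewrite /= (ltn_eqF (_ : k < n.+2)%N); last by lia.
have [e|ne] := eqVneq k n.+1.
  rewrite e eqxx !E; have := h1 j.-1; rewrite prednK //; apply; lia.
have kn' : (k <= n)%N by lia.
have := h2 k j j0 jk kn'; rewrite /= (ltn_eqF (_ : k < n.+1)%N) //.
rewrite !eqSS (negbTE ne); case: eqP => [->|//]; by rewrite !E.
Qed.

Lemma GCpattern_eq (R : realFieldType) n (top top' y y' : nat -> R) :
  (forall j, (j <= n)%N -> top j = top' j) ->
  (forall q, (q < NN n)%N -> y q = y' q) ->
  GCpattern n top y -> GCpattern n top' y'.
Proof.
move=> et ey h k j j0 jk kn; have := h k j j0 jk kn => /=.
rewrite !(ltn_eqF (_ : k < n.+1)%N) // eqSS; case: eqP => [e|ne].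
  by rewrite -!et ?ey ?gcIdx_lt //; lia.
by rewrite !ey // gcIdx_lt //; lia.
Qed.

(** A value [g j] out of range gives a zero column, in agreement with the default of [coord]. *)
Definition pick_mx (m n : nat) (g : nat -> nat) : 'M[int]_(m, n) :=
  \matrix_(i, j) (i == g j :> nat)%:R.

Lemma mul_pick_mx (R : realFieldType) m n (g : nat -> nat) (x : 'rV[R]_m) (j : 'I_n) :
  (x *m map_mx intr (pick_mx m n g)) 0 j = coord x (g j).
Proof.
rewrite mxE /coord [RHS]big_mkcond; apply: eq_bigr => i _; rewrite !mxE /=.
by case: eqP => _; rewrite ?mulr1 ?mulr0.
Qed.

(** [F] lists the entries of the inverse matrix; its vanishing beyond the range accounts for the
    zero columns. *)
Lemma unit_pick_mxB n (g1 g2 : nat -> nat) (F : nat -> nat -> int) :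
  (forall i l, (i < n <= l)%N -> F i l = 0) ->
  (forall i j, (i < n)%N -> (j < n)%N -> F i (g1 j) - F i (g2 j) = (i == j)%:R) ->
  pick_mx n n g1 - pick_mx n n g2 \in unitmx.
Proof.
move=> F0 F1; apply: (@mulmx1_unit _ _ (\matrix_(i, l) F i l) _ _).2.
apply/matrixP => i j; rewrite mulmxBr !mxE -(F1 _ _ (ltn_ord i) (ltn_ord j)).
have E g : \sum_(l < n) (\matrix_(i, l) F i l : 'M_n) i l * pick_mx n n g l j = F i (g j).
  have [lt_g|ge_g] := ltnP (g j) n; last first.
    rewrite F0 ?ge_g ?ltn_ord // big1 // => l _; rewrite !mxE.
    by rewrite (ltn_eqF (leq_trans (ltn_ord l) ge_g)) mulr0.
  rewrite (bigD1 (Ordinal lt_g)) //= !mxE eqxx mulr1 big1 ?addr0 // => l ne.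
  rewrite !mxE; case: eqP => [e|_]; last by rewrite mulr0.
  by case/eqP: ne; apply: val_inj.
by rewrite !E.
Qed.

(** An equivalence of memberships is enough, since an invertible integer matrix makes the map a
    bijection; integrality of [B] makes the translation integral as soon as the top row is. *)
Definition GCequiv (R : realFieldType) (N n : nat) (i : seq nat) : Prop :=
  exists (M : 'M[int]_N) (B : 'M[int]_(n.+1, N)), M \in unitmx /\
    forall (m : 'rV[R]_n.+1) (x : 'rV[R]_N),
      stringIneq n i (fun a => coord m a.-1 - coord m a) (fun j => coord x j.-1) <->
      GCpattern n (coord m) (coord (x *m map_mx intr M + m *m map_mx intr B)).

Lemma coord_lshift (R : realFieldType) N n (x : 'rV[R]_N) (c : 'rV[R]_n) q :
  (q < N)%N -> coord (row_mx x c) q = coord x q.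
Proof.
move=> lt_q; rewrite -[q]/(val (Ordinal lt_q)) coord_ord.
by rewrite -(row_mxEl x c) -coord_ord.
Qed.

Lemma coord_rshift (R : realFieldType) N n (x : 'rV[R]_N) (c : 'rV[R]_n) q :
  coord (row_mx x c) (N + q)%N = coord c q.
Proof.
have [lt_q|ge_q] := ltnP q n; last by rewrite !coord_out ?leq_add2l.
rewrite -[q]/(val (Ordinal lt_q)) coord_ord.
by rewrite -(row_mxEr x c) -coord_ord.
Qed.

(** Both chain types are handled at once: [h], [g1], [g2] describe the row [z], and [F] inverts its
    dependence on the chain coordinates. *)
Lemma GCequiv_step (R : realFieldType) n i u (h g1 g2 : nat -> nat) (F : nat -> nat -> int) :
  Sigma n u ->
  (forall i l, (i < n.+1 <= l)%N -> F i l = 0) ->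
  (forall i j, (i < n.+1)%N -> (j < n.+1)%N -> F i (g1 j) - F i (g2 j) = (i == j)%:R) ->
  (forall (mu t : nat -> R)
     (z := fun j => mu (h j) + t (NN n + (g1 j).+1)%N - t (NN n + (g2 j).+1)%N),
     t (NN n + n.+2)%N = 0 ->
     stringIneq n.+1 i (fun a => mu a.-1 - mu a) t <->
     (forall j, (j <= n)%N -> z j <= mu j /\ mu j.+1 <= z j) /\
     stringIneq n u (fun a => z a.-1 - z a) t) ->
  GCequiv R (NN n) n u -> GCequiv R (NN n.+1) n.+1 i.
Proof.
move=> Su F0 F1 H [M [B [uM HM]]]; rewrite NN_S.
pose T := pick_mx n.+1 n.+1 g1 - pick_mx n.+1 n.+1 g2.
pose G := pick_mx n.+2 n.+1 h.
have uT : T \in unitmx by apply: unit_pick_mxB F0 F1.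
(* Substituting [z = c T + m G] into the given map [x' M + z B] and appending [z] itself produces
   these blocks; the determinant is [det M * det T]. *)
exists (block_mx M 0 (T *m B) T), (row_mx (G *m B) G); split.
  by rewrite unitmxE det_lblock unitrM -!unitmxE uM.
move=> m x; rewrite -[x]hsubmxK; set x' := lsubmx x; set c := rsubmx x.
pose z : 'rV[R]_n.+1 := c *m map_mx intr T + m *m map_mx intr G.
have -> : row_mx x' c *m map_mx intr (block_mx M 0 (T *m B) T) +
    m *m map_mx intr (row_mx (G *m B) G) =
    row_mx (x' *m map_mx intr M + z *m map_mx intr B) z.
  rewrite map_block_mx map_row_mx mul_row_block mul_mx_row add_row_mx !map_mxM map_mx0.
  by rewrite mulmx0 add0r /z mulmxDl !mulmxA addrA.
set t := fun j => coord (row_mx x' c) j.-1.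
have tE q : t (NN n + q.+1)%N = coord c q by rewrite -(coord_rshift x' c); congr Defs.coord; lia.
have zE j : (j <= n)%N -> coord z j =
    coord m (h j) + t (NN n + (g1 j).+1)%N - t (NN n + (g2 j).+1)%N.
  move=> hj; have lt_j : (j < n.+1)%N by [].
  rewrite !tE -[j in LHS]/(val (Ordinal lt_j)) coord_ord [LHS]mxE.
  have sub (X Y : 'rV[R]_n.+1) q : (X - Y) 0 q = X 0 q - Y 0 q by rewrite !mxE.
  rewrite /T map_mxB mulmxBr sub !mul_pick_mx /=; ring.
rewrite (H (coord m) t); last by rewrite tE coord_out.
rewrite GCpattern_rec.
have yE j : coord (row_mx (x' *m map_mx intr M + z *m map_mx intr B) z) (NN n + j)%N = coord z j.
  exact: coord_rshift.
set C1 := forall j, _; set C2 := forall j, _.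
have e1 : C1 <-> C2.
  by split=> hC j hj; have := hC j hj; rewrite yE zE.
rewrite e1; suff -> : stringIneq n u (fun a => coord m (h a.-1) + t (NN n + (g1 a.-1).+1)%N -
     t (NN n + (g2 a.-1).+1)%N - (coord m (h a) + t (NN n + (g1 a).+1)%N - t (NN n + (g2 a).+1)%N)) t <->
   GCpattern n (fun j => coord (row_mx (x' *m map_mx intr M + z *m map_mx intr B) z) (NN n + j)%N)
     (coord (row_mx (x' *m map_mx intr M + z *m map_mx intr B) z)) by [].
have tx j : (0 < j <= NN n)%N -> t j = coord x' j.-1.
  by move=> hj; rewrite /t coord_lshift //; lia.
split=> hs.
  apply: (@GCpattern_eq R n (coord z) _ (coord (x' *m map_mx intr M + z *m map_mx intr B))).
  - by move=> j _; rewrite yE.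
  - by move=> q hq; rewrite coord_lshift.
  apply/HM; apply: stringIneq_eq hs => // a ha; rewrite !zE //; lia.
have /HM : GCpattern n (coord z) (coord (x' *m map_mx intr M + z *m map_mx intr B)).
  apply: GCpattern_eq hs => [j _|q hq]; first by rewrite yE.
  by rewrite coord_lshift.
apply: stringIneq_eq => // [j hj|a ha]; first by rewrite tx.
by rewrite !zE //; lia.
Qed.

Lemma GCequiv_D (R : realFieldType) n u : Sigma n.+1 (u ++ rev (iota 1 n.+1)) ->
  GCequiv R (NN n) n u -> GCequiv R (NN n.+1) n.+1 (u ++ rev (iota 1 n.+1)).
Proof.
(* The chain coordinates enter [z] through consecutive differences, so summation inverts the
   dependence: each [c] is minus a partial sum of [z - mu]. *)
move=> Si; apply: (@GCequiv_step R n _ u id (fun j => n.+1 - j)%N (fun j => n - j)%N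
  (fun i l => - (l < n.+1 - i)%N%:R)).
- exact: Sigma_D Si.
- by move=> i l /andP[hi hl]; rewrite ltnNge (leq_trans (leq_subr _ _) hl) oppr0.
- move=> i j hi hj; have -> : (n.+1 - j < n.+1 - i)%N = (i < j)%N by lia.
  have -> : (n - j < n.+1 - i)%N = (i <= j)%N by lia.
  by case: ltngtP.
- by move=> mu t z t0; apply: stringIneq_D.
Qed.

Lemma GCequiv_A (R : realFieldType) n u : Sigma n.+1 (map succn u ++ iota 1 n.+1) -> Sigma n u ->
  GCequiv R (NN n) n u -> GCequiv R (NN n.+1) n.+1 (map succn u ++ iota 1 n.+1).
Proof.
move=> Si Su; apply: (@GCequiv_step R n _ u succn id succn
  (fun i l => (l <= i)%N%:R)) => //.
- by move=> i l hil; rewrite leqNgt (_ : i < l)%N //; lia.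
- by move=> i j hi hj; case: ltngtP.
- by move=> mu t z t0; apply: stringIneq_A.
Qed.

(** A 2-move exchanges two coordinates, so [M] is multiplied by a transposition matrix and [B] stays
    the same. *)
Lemma GCequiv_two_move (R : realFieldType) n w w' : Sigma n w -> two_move w w' ->
  GCequiv R (NN n) n w' -> GCequiv R (NN n) n w.
Proof.
move=> Sw [u [v [a [b [ew ew' far_ab]]]]] [M [B [uM HM]]]; rewrite ew in Sw *; rewrite ew' in HM.
have Sw' : Sigma n (u ++ b :: a :: v) by apply: two_move_Sigma Sw; exists u, v, a, b.
have szw := Sigma_size Sw; rewrite size_cat /= in szw.
have lt1 : (size u < NN n)%N by lia.
have lt2 : ((size u).+1 < NN n)%N by lia.
pose s : 'M[int]_(NN n) := tperm_mx (Ordinal lt1) (Ordinal lt2).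
exists (s *m M), B; split; first by rewrite unitmx_mul uM unitmx_perm.
move=> m x; rewrite map_mxM mulmxA.
have far_ba : far b a by rewrite farC.
set t := fun j => coord x j.-1.
have -> : stringIneq n (u ++ a :: b :: v) (fun a => coord m a.-1 - coord m a) t <->
    stringIneq n (u ++ b :: a :: v) (fun a => coord m a.-1 - coord m a) (t \o node_swap (size u).+1).
  split=> hs; first exact: two_move_stringIneq.
  apply: (@stringIneq_eq R n _ _ _ _ t Sw _ _ (two_move_stringIneq far_ba Sw' hs)) => // j _ /=.
  by rewrite node_swapK.
rewrite -HM.
suff E j : (0 < j <= NN n)%N -> (t \o node_swap (size u).+1) j = coord (x *m map_mx intr s) j.-1.
  by split; apply: stringIneq_eq => // j /E.
case: j => // j /andP[_ lt_j].
rewrite /s map_perm_mx -xcolE -[j.+1.-1]/(val (Ordinal lt_j)) coord_ord mxE -coord_ord /t /=.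
congr (coord x _); rewrite /node_swap !eqSS.
case: perm.tpermP => [/(congr1 val)/= ->|/(congr1 val)/= ->|ne1 ne2] /=.
- by rewrite eqxx.
- by rewrite gtn_eqF // eqxx.
rewrite !ifN //; apply/eqP => e.
  by apply: ne2; apply: val_inj.
by apply: ne1; apply: val_inj.
Qed.

Lemma GCequiv_wsim (R : realFieldType) n w w' : wsim w w' -> Sigma n w ->
  GCequiv R (NN n) n w' -> GCequiv R (NN n) n w.
Proof.
move=> ww' Sw.
(* The implication is carried along from [w], where it is trivial; [Sigma] travels with it because
   every single 2-move needs it. *)
pose P w1 := Sigma n w1 /\ (GCequiv R (NN n) n w1 -> GCequiv R (NN n) n w).
have [h _] : P w <-> P w'.
  apply: wsim_inv ww' => w1 w2 w12 [S1 h1]; have S2 := two_move_Sigma w12 S1.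
  by split=> // Q2; apply/h1/(GCequiv_two_move S1 w12).
by have [|_] := h; first by split.
Qed.

Lemma GCequiv0 (R : realFieldType) i : GCequiv R (NN 0) 0 i.
Proof.
exists 1%:M, 0; split; first exact: unitmx1.
by move=> m x; split=> _; [move=> k j | split=> [k p | j]]; rewrite ?/NN ?div0n; lia.
Qed.

Lemma GCequiv_indices (R : realFieldType) n (sigma : nat -> AD) (w : nat -> seq nat) :
  Sigma n (w n) ->
  (forall k, (1 <= k <= n)%N ->
     contrIs (sigma k) k (w k) (w k.-1) /\ indIs (sigma k) k (w k) 0) ->
  GCequiv R (NN n) n (w n).
Proof.
elim: n => [|n IHn] Sw hw; first exact: GCequiv0.
have [[u [v [wv wc]]] [u' [v' [wu' /size0nil v'0]]]] := hw n.+1 (ltnSn n).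
have step : Sigma n (w n) -> GCequiv R (NN n) n (w n).
  by move=> Sn; apply: IHn => // k hk; apply: hw; lia.
rewrite /decomp in wv; rewrite /decomp {v'}v'0 cats0 in wu'; move: wv wc wu'; case: (sigma n.+1) => /= wv wc wu'.
(* With an empty tail the contraction is [u] shifted down, hence reduced of rank [n], and the
   induction applies to it. *)
- have v0 : v = [::] := ind0_A Sw wv wu'.
  rewrite {}v0 /= ?cats0 in wv wc.
  have Sv := (wsim_Sigma n.+1 wv).1 Sw; have [eu Su] := Sigma_A Sv.
  have Sn : Sigma n (w n) := (wsim_Sigma n wc).2 Su.
  apply: (GCequiv_wsim wv Sw); rewrite eu; apply: GCequiv_A => //; first by rewrite -eu.
  by apply: GCequiv_wsim (step Sn) => //; apply: rst_sym.
- have v0 : v = [::] := ind0_D Sw wv wu'.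
  rewrite {}v0 /= ?cats0 in wv wc.
  have Sv := (wsim_Sigma n.+1 wv).1 Sw; have Su := Sigma_D Sv.
  have Sn : Sigma n (w n) := (wsim_Sigma n wc).2 Su.
  apply: (GCequiv_wsim wv Sw); apply: GCequiv_D => //.
  by apply: GCequiv_wsim (step Sn) => //; apply: rst_sym.
Qed.

Local Close Scope ring_scope.

(* w k stands for C_{sigma_{k+1}} o ... o C_{sigma_n} (i)  (up to ~), in Sigma_{k+1} *)
Theorem mainTheorem15 (R : realFieldType) (n : nat) (i : seq nat) :
  1 <= n -> Sigma n i ->
  (exists (sigma : nat -> AD) (w : nat -> seq nat),
      w n = i /\
      forall k, 1 <= k <= n ->
        contrIs (sigma k) k (w k) (w k.-1) /\ indIs (sigma k) k (w k) 0) ->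
  forall lam : nat -> nat,
    unimodEquiv (@stringPoly R n i lam) (@GCpoly R n lam).
Proof.
move=> _ Si [sigma [w [ew hw]]] lam; rewrite -ew in Si *.
have [M [B [uM HM]]] := GCequiv_indices R Si hw.
(* The top row belonging to [lam], taken over the integers so that [m *m B] is an integral
   translation. *)
pose m : 'rV[int]_n.+1 := (\row_(j < n.+1) \sum_(j.+1 <= l < n.+1) (lam l)%:R)%R.
pose m' : 'rV[R]_n.+1 := map_mx intr m.
have mE j : j <= n -> coord m' j = (\sum_(j.+1 <= l < n.+1) (lam l)%:R)%R.
  move=> hj; have lt_j : j < n.+1 by [].
  rewrite -[j in LHS]/(val (Ordinal lt_j)) coord_ord !mxE rmorph_sum /=.
  by apply: eq_bigr => l _; rewrite rmorph_nat.
have H (x : 'rV[R]_(NN n)) : stringPoly (w n) lam x <->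
    GCpoly lam (x *m map_mx intr M + map_mx intr (m *m B))%R.
  rewrite stringPolyE GCpolyE map_mxM -/m'; split=> h.
    apply: (@GCpattern_eq R n (coord m') _ _ _ mE (fun _ _ => erefl)); apply/HM.
    apply: stringIneq_eq h => // a /andP[a0 an]; rewrite !mE //; last by lia.
    rewrite prednK // (big_ltn (_ : a < n.+1)) //; ring.
  have /HM : GCpattern n (coord m') (coord (x *m map_mx intr M + m' *m map_mx intr B)%R).
    by apply: GCpattern_eq h => // j hj; rewrite mE.
  apply: stringIneq_eq => // a /andP[a0 an]; rewrite !mE //; last by lia.
  rewrite prednK // (big_ltn (_ : a < n.+1)) //; ring.
exists M, (m *m B)%R; split=> //=; split=> [x /H //|y Qy].
pose x : 'rV[R]_(NN n) := ((y - map_mx intr (m *m B)) *m map_mx intr (invmx M))%R.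
have ex : (x *m map_mx intr M + map_mx intr (m *m B))%R = y.
  by rewrite -mulmxA -map_mxM mulVmx // map_mx1 mulmx1 subrK.
by exists x; split=> //; apply/H; rewrite ex.
Qed.
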